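(* Let $A_n$ denote Andreev's function on $n$ bits. Any function $f:\{0,1\}^n\to\{0,1\}$ that agrees with $A_n$ on at least a $(1/2+\epsilon)$-fraction of inputs, for some $\epsilon \gg \sqrt{\log(n)/n}$, cannot be computed by ${\sf LTF}\circ{\sf LTF}$ circuits with fewer than $\Omega(\epsilon^3 n^{3/2}/\log^3 n)$ gates, nor by ${\sf LTF}\circ{\sf LTF}$ circuits with fewer than $\Omega(\epsilon^3 n^{5/2}/\log^{7/2} n)$ wires.
   Context: A linear threshold function (LTF) $g:\{0,1\}^N\to\{0,1\}$ is one for which there are real weights $w_1,\dots,w_N,t$ with $g(a)=1$ iff $\sum_i w_i a_i\ge t$. An ${\sf LTF}\circ{\sf LTF}$ circuit (depth-two LTF circuit) consists of a layer of LTF gates (with arbitrary real weights) each reading input variables, and a single output LTF gate whose inputs may be input variables and outputs of the bottom-layer gates. Its number of gates is the number of LTF gates; its number of wires is the total number of input connections of all gates. The $k$-bit multiplexer is $M_{2^k}(x_1,\dots,x_{2^k},a_1,\dots,a_k)=x_{\mathrm{bin}(a_1\cdots a_k)}$, where $\mathrm{bin}:\{0,1\}^k\to\{1,\dots,2^k\}$ is the standard bijection from $k$-bit strings to indices. For $k$ a power of two and $n=2\cdot 2^k$, Andreev's function on inputs $x\in\{0,1\}^{2^k}$ and $a_{i,j}\in\{0,1\}$ ($1\le i\le k$, $1\le j\le 2^k/k$) is $A_n(x,a)=M_{2^k}\big(x,\ \sum_j a_{1,j}\bmod 2,\ \dots,\ \sum_j a_{k,j}\bmod 2\big)$. The asymptotic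 notation is as $n\to\infty$; ''$\epsilon\gg\sqrt{\log(n)/n}$'' means $\epsilon$ exceeds a sufficiently large constant multiple of $\sqrt{\log(n)/n}$. *)

(* Defs.v *)
From HB Require Import structures.
From mathcomp Require Import all_boot all_order all_algebra.
From mathcomp Require Import reals.

Set Implicit Arguments.
Unset Strict Implicit.
Unset Printing Implicit Defensive.

Import Order.TTheory GRing.Theory Num.Theory.

Local Open Scope ring_scope.

Notation bits V := {ffun V -> bool}.

(* An LTF gate whose sources are indexed by V. Only the sources in
   [ltf_inputs] are wired to the gate. *)
Record ltf (R : realType) (V : finType) := Ltf {
  ltf_inputs : {set V};
  ltf_weight : V -> R;
  ltf_threshold : R
}.

Definition ltf_eval (R : realType) (V : finType) (g : ltf R V) (a : bits V) :
    bool :=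
  ltf_threshold g <= \sum_(i in ltf_inputs g) ltf_weight g i * (a i)%:R.

Definition fan_in (R : realType) (V : finType) (g : ltf R V) : nat :=
  #|ltf_inputs g|.

(* The output gate may read both input variables (left summand) and outputs of
   bottom gates (right summand). *)
Record ltf_ltf (R : realType) (V : finType) := LtfLtf {
  bottom_size : nat;
  bottom_gate : 'I_bottom_size -> ltf R V;
  output_gate : ltf R (V + 'I_bottom_size)%type
}.

Definition circuit_eval (R : realType) (V : finType) (C : ltf_ltf R V)
    (a : bits V) : bool :=
  ltf_eval (output_gate C)
    [ffun v => match v with
               | inl i => a i
               | inr j => ltf_eval (bottom_gate j) a
               end].

Definition computes (R : realType) (V : finType) (C : ltf_ltf R V)
    (f : bits V -> bool) : Prop :=
  forall a : bits V, circuit_eval C a = f a.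

Definition gates (R : realType) (V : finType) (C : ltf_ltf R V) : nat :=
  (bottom_size C).+1.

Definition wires (R : realType) (V : finType) (C : ltf_ltf R V) : nat :=
  (\sum_(j < bottom_size C) fan_in (bottom_gate j) + fan_in (output_gate C))%N.

Definition agreement (R : realType) (V : finType) (f g : bits V -> bool) : R :=
  #|[set a | f a == g a]|%:R / #|{: bits V}|%:R.

(* The string a_1 ... a_k is read most significant bit first; the index set
   {1, ..., 2^k} is shifted to {0, ..., 2^k - 1}. *)
Definition bin_nat (k : nat) (a : bits 'I_k) : nat :=
  (\sum_(i < k) a i * 2 ^ (k - i.+1))%N.

Lemma bin_nat_recl (k : nat) (a : bits 'I_k.+1) :
  bin_nat a = (a ord0 * 2 ^ k + bin_nat [ffun i : 'I_k => a (lift ord0 i)])%N.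
Proof.
rewrite /bin_nat big_ord_recl /= subn1 /=; congr addn.
by apply: eq_bigr => i _; rewrite ffunE /= /bump /= add1n subSS.
Qed.

Lemma bin_subproof (k : nat) (a : bits 'I_k) : (bin_nat a < 2 ^ k)%N.
Proof.
elim: k a => [|k IHk] a; first by rewrite /bin_nat big_ord0.
rewrite bin_nat_recl expnS mul2n -addnn -addnS; apply: leq_add (IHk _).
by case: (a ord0); rewrite ?mul1n ?mul0n.
Qed.

Definition bin (k : nat) (a : bits 'I_k) : 'I_(2 ^ k) :=
  Ordinal (bin_subproof a).

Lemma bin_bij (k : nat) : bijective (@bin k).
Proof.
apply: inj_card_bij; last by rewrite card_ffun card_bool !card_ord.
move=> a b /(congr1 val) /=.
elim: k a b => [|k IHk] a b; first by move=> _; apply/ffunP => -[].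
have h (c : bits 'I_k.+1) := bin_subproof [ffun i : 'I_k => c (lift ord0 i)].
rewrite !bin_nat_recl => e.
have e0 : a ord0 = b ord0.
  have := h a; have := h b; move: e.
  case: (a ord0) (b ord0) => -[] //; rewrite mul1n mul0n add0n.
    by move=> <-; rewrite ltnNge leq_addr.
  by move=> -> _; rewrite ltnNge leq_addr.
move: e; rewrite e0 => /addnI /IHk e; apply/ffunP => i.
case: (unliftP ord0 i) => [j|] -> //.
by move/ffunP/(_ j): e; rewrite !ffunE.
Qed.

Definition multiplexer (k : nat) (x : bits 'I_(2 ^ k)) (a : bits 'I_k) : bool :=
  x (bin a).

(* [inl p] indexes the variable x_p, and [inr (i, j)] the variable a_{i,j}. *)
Definition andreev_var (k : nat) : finType :=
  ('I_(2 ^ k) + 'I_k * 'I_(2 ^ k %/ k))%type.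

Lemma card_andreev_var (m k : nat) :
  k = (2 ^ m)%N -> #|andreev_var k| = (2 * 2 ^ k)%N.
Proof.
move=> hk; rewrite card_sum card_prod !card_ord mulnC divnK ?addnn ?mul2n //.
by rewrite {1}hk dvdn_exp2l // hk ltnW // ltn_expl.
Qed.

Definition andreev (k : nat) (z : bits (andreev_var k)) : bool :=
  multiplexer [ffun p => z (inl p)]
    [ffun i : 'I_k => odd (\sum_(j < 2 ^ k %/ k) z (inr (i, j)))].

(* Main.v *)
(** Fix one variable [(i, J i)] in each parity block and let these [k] variables
   vary, starting from a uniformly random input.  On this random subcube Andreev's
   function is a shift of the random truth table [x], so a fixed function of [k]
   bits agrees with it on more than a [(1 + eps) / 2] fraction only with probability
   [exp (- Omega (eps^2 n))].

   On the other hand the subcube simplifies the circuit.  A bottom gate varies on it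
   only if the fixed part of its weighted sum falls in a short interval.  That
   interval is cut into pieces of lengths [|w_v|], [v] ranging over the free inputs,
   and each piece is handled by the Littlewood-Offord inequality; averaging over [J]
   bounds the expected number of gates that vary and read two or more free
   variables.  The remaining gates are affine in a single bit and are absorbed by
   the output gate.  By Chow's theorem few functions are computed by circuits with
   few bottom gates on [k] bits, and a union bound concludes.

   When [eps sqrt n] is [O(log n)] the gate bound is trivial, and for the wire bound
   [J i] is chosen deterministically, as the variable of least fan-out in its
   block. *)

Require Import Defs.
From HB Require Import structures.
From mathcomp Require Import all_boot all_order all_algebra.
From mathcomp Require Import reals sequences exp.
From mathcomp Require Import ring lra zify.

Set Implicit Arguments.
Unset Strict Implicit.
Unset Printing Implicit Defensive.

Import Order.TTheory GRing.Theory Num.Theory.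

Local Open Scope ring_scope.

(** * Littlewood-Offord inequality *)

Section BitVectors.
Variable V : finType.
Implicit Types z y : bits V.

Definition bxor z y : bits V := [ffun v => z v (+) y v].
Definition unit_bits (u : V) : bits V := [ffun v => v == u].

Lemma bxorK y : involutive (bxor^~ y).
Proof. by move=> z; apply/ffunP => v; rewrite !ffunE addbK. Qed.

Lemma sum_bxor (M : nmodType) (F : bits V -> M) y :
  \sum_z F (bxor z y) = \sum_z F z.
Proof. by rewrite [RHS](reindex_inj (inv_inj (bxorK y))). Qed.

End BitVectors.

Section LittlewoodOfford.
Variables (R : realType) (V : finType).
Implicit Types z y : bits V.

(** The Rademacher sign of bit [u], oriented so that [1] marks the setting with the larger weighted
    sum. *)
Definition orient (w : V -> R) (u : V) z : R :=
  (if 0 <= w u then 1 else -1) * (2 * (z u)%:R - 1).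

Lemma orient_sqr w u z : orient w u z * orient w u z = 1.
Proof. by rewrite /orient; case: ifP => _; case: (z u); rewrite /=; ring. Qed.

Lemma orient_flip w u v z :
  orient w v (bxor z (unit_bits u)) = (if v == u then -1 else 1) * orient w v z.
Proof.
rewrite /orient !ffunE; case: eqP => _; last by rewrite addbF; ring.
by rewrite addbT; case: (z v) => /=; ring.
Qed.

(** For [u != v], flipping bit [u] permutes the inputs and negates the product, so the sum equals
    its own negative. *)
Lemma sum_orient_orient w u v :
  \sum_z orient w u z * orient w v z = (u == v)%:R * #|{: bits V}|%:R.
Proof.
case: eqP => [->|/eqP uv].
  by under eq_bigr do rewrite orient_sqr; rewrite sumr_const mul1r.
have := sum_bxor (fun z => orient w u z * orient w v z) (unit_bits u).
under eq_bigr do rewrite !orient_flip eqxx eq_sym (negPf uv) mul1r mulN1r mulNr.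
rewrite sumrN mul0r; lra.
Qed.

Lemma sum_sqr_orient w (A : {set V}) :
  \sum_z (\sum_(u in A) orient w u z) ^+ 2 = #|A|%:R * #|{: bits V}|%:R.
Proof.
under eq_bigr => z _.
  rewrite expr2 big_distrl /=.
  under eq_bigr => u _ do rewrite big_distrr /=.
  over.
rewrite exchange_big /=.
rewrite mulr_natl -sumr_const; apply: eq_bigr => u uA.
rewrite exchange_big /= (bigD1 u) //= sum_orient_orient eqxx mul1r big1 ?addr0 //.
by move=> v /andP[_ /negPf]; rewrite eq_sym sum_orient_orient => ->; rewrite mul0r.
Qed.

Definition wsum (D : {set V}) (w : V -> R) z : R :=
  \sum_(v in D) w v * (z v)%:R.

Lemma wsum_flip (D : {set V}) w u z : u \in D ->
  wsum D w z - wsum D w (bxor z (unit_bits u)) = `|w u| * orient w u z.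
Proof.
move=> uD; rewrite /wsum -sumrB (bigD1 u) //= big1 ?addr0; last first.
  by move=> v /andP[_ /negPf vu]; rewrite !ffunE vu addbF subrr.
rewrite !ffunE eqxx addbT /orient; case: ifPn => [w0|]; last rewrite -ltNge => w0.
  by rewrite ger0_norm //; case: (z u) => /=; ring.
by rewrite ltr0_norm //; case: (z u) => /=; ring.
Qed.

Definition side (c d y : R) : R := if y < c then -1 else if y < c + d then 0 else 1.

(** A half-open interval of length [d] contains at most one of two points at distance at least [d],
    and leaving it changes [side] by one. *)
Lemma side_step (c d y y' : R) : 0 <= d -> y' + d <= y ->
  side c d y' + ((c <= y < c + d)%R%:R + (c <= y' < c + d)%R%:R) <= side c d y.
Proof.
rewrite /side => d0 yy'.
by do !case: ltP => ? /=; lra.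
Qed.

(* On the event [E] the step function [h] vanishes, and flipping any [u] in [A] leaves
   the interval, so [h] correlates with each [orient w u] by at least [#|E|]. The
   variables [orient w u] are orthonormal, so [h] correlates with their sum by at most
   [sqrt #|A|]. *)
Lemma littlewood_offord (D A : {set V}) (w : V -> R) (c d : R) :
  A \subset D -> 0 <= d -> {in A, forall u, d <= `|w u|} ->
  #|[set z | c <= wsum D w z < c + d]|%:R * Num.sqrt (#|A|%:R)
    <= #|{: bits V}|%:R :> R.
Proof.
move=> AD d0 Aw.
set E := [set z | _]; set s := Num.sqrt _.
have [A0|A0] := posnP #|A|; first by rewrite /s A0 sqrtr0 mulr0 ler0n.
have s0 : 0 < s by rewrite sqrtr_gt0 ltr0n.
have ss : s * s = #|A|%:R by rewrite -expr2 sqr_sqrtr ?ler0n.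
pose h z := side c d (wsum D w z).
have EE : #|E|%:R = \sum_z (z \in E)%:R :> R.
  by rewrite -sum1_card natr_sum big_mkcond /=; apply: eq_bigr => z _; case: ifP.
have step u : u \in A -> #|E|%:R <= \sum_z h z * orient w u z.
  move=> uA; set y := unit_bits u.
  have e1 : \sum_z h (bxor z y) * orient w u z = - \sum_z h z * orient w u z.
    rewrite -(sum_bxor _ y) -sumrN; apply: eq_bigr => z _.
    by rewrite bxorK orient_flip eqxx; ring.
  have e2 : \sum_z (z \in E)%:R = \sum_z (bxor z y \in E)%:R :> R.
    by rewrite -(sum_bxor _ y).
  (* Pairing [z] with its flip doubles both sides, so a pointwise inequality for the pair
     suffices. *)
  suff : \sum_z ((z \in E)%:R + (bxor z y \in E)%:R)
      <= \sum_z (h z * orient w u z - h (bxor z y) * orient w u z).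
    rewrite big_split /= -e2 -EE sumrB e1; lra.
  apply: ler_sum => z _; rewrite !inE -mulrBl /h.
  have := wsum_flip w z (subsetP AD _ uA); rewrite -/y.
  have := Aw _ uA; set Y := wsum D w z; set Y' := wsum D w _.
  have : orient w u z = 1 \/ orient w u z = -1.
    by rewrite /orient; case: ifP; case: (z u) => /=; [left|right|right|left]; ring.
  case=> -> dw yy.
    by have := @side_step c d Y Y' d0 ltac:(lra); lra.
  by have := @side_step c d Y' Y d0 ltac:(lra); lra.
have le1 : #|A|%:R * #|E|%:R <= \sum_z h z * \sum_(u in A) orient w u z.
  rewrite [X in _ <= X](_ : _ = \sum_(u in A) \sum_z h z * orient w u z).
    by rewrite mulr_natl -sumr_const; apply: ler_sum.
  by rewrite exchange_big; apply: eq_bigr => z _; rewrite big_distrr.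
have le2 : s * (\sum_z h z * \sum_(u in A) orient w u z)
    <= s * (s * #|{: bits V}|%:R).
  (* Cauchy-Schwarz in the form [s * h * X <= X^2 / 2 + s^2 / 2], valid as [h^2 <= 1]; the second
     moment of [X] makes the two halves equal in total. *)
  have -> : s * (s * #|{: bits V}|%:R) =
    \sum_z ((\sum_(u in A) orient w u z) ^+ 2 / 2 + s * s / 2).
    rewrite big_split /= -mulr_suml sum_sqr_orient -ss sumr_const -mulr_natl.
    by field.
  rewrite mulr_sumr; apply: ler_sum => z _ /=.
  set X := \sum_(u in A) _.
  have : h z ^+ 2 <= 1 by rewrite /h /side; do !case: ifP => _; lra.
  have := sqr_ge0 (X - s * h z); nra.
rewrite ler_pM2l // in le2.
by rewrite -(ler_pM2l s0) mulrCA mulrC ss; apply: le_trans le2.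
Qed.

End LittlewoodOfford.

(** * Sums of inverse square roots over ranks, and tilings of an interval *)

Section InverseSqrt.
Variable R : realType.

(* [maxn 1 m] keeps [isqrt 0 = 1], where the inverse of 0 would give 0. *)
Definition isqrt (m : nat) : R := (Num.sqrt (maxn 1 m)%:R)^-1.

Lemma isqrt_ge0 m : 0 <= isqrt m.
Proof. by rewrite invr_ge0 sqrtr_ge0. Qed.

Lemma isqrt_le m n : (m <= n)%N -> isqrt n <= isqrt m.
Proof.
move=> mn; rewrite lef_pV2 ?posrE ?sqrtr_gt0 ?ltr0n ?leq_maxl //.
by rewrite ler_sqrt ?ler0n // ler_nat geq_max leq_maxl leq_max mn orbT.
Qed.

Lemma isqrt_le1 m : isqrt m <= 1.
Proof. by rewrite (le_trans (isqrt_le (leq0n m))) // /isqrt sqrtr1 invr1. Qed.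

(** The terms with [r < k] equal 1, because the subtraction truncates and [isqrt 0 = 1]. The others
    telescope by [1 / sqrt (j+1) <= 2 (sqrt (j+1) - sqrt j)]. *)
Lemma sum_isqrt (k w : nat) :
  \sum_(r < w) isqrt (r.+1 - k) <= (minn w k)%:R + 2 * Num.sqrt (w - k)%:R.
Proof.
elim: w => [|w IH]; first by rewrite big_ord0 addr_ge0 // mulr_ge0 ?sqrtr_ge0.
rewrite big_ord_recr /=; case: (ltnP w k) => wk.
  have -> : minn w.+1 k = w.+1 by lia.
  have -> : (w.+1 - k)%N = 0%N by lia.
  move: IH; have -> : minn w k = w by lia.
  have -> : (w - k)%N = 0%N by lia.
  have := isqrt_le1 0; rewrite sqrtr0 [w.+1%:R]mulrSr; lra.
have -> : minn w.+1 k = k by lia.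
move: IH; have -> : minn w k = k by lia.
rewrite subSn // /isqrt; set m := (w - k)%N.
have -> : maxn 1 m.+1 = m.+1 by lia.
set a := Num.sqrt m%:R; set b := Num.sqrt m.+1%:R => IH.
have b0 : 0 < b by rewrite sqrtr_gt0 ltr0n.
have bb : b * b = m%:R + 1 by rewrite -expr2 sqr_sqrtr ?ler0n // [m.+1%:R]mulrSr.
have aa : a * a = m%:R by rewrite -expr2 sqr_sqrtr ?ler0n.
suff : 2 * a + b^-1 <= 2 * b by lra.
rewrite -(ler_pM2r b0) mulrDl mulVf ?gt_eqF //.
have := sqr_ge0 (a - b); nra.
Qed.

(** Remove an element where [x] is smallest: its rank is [#|A|], which is the last term. The removal
    can only lower the other ranks, hence only raise their values under [F]. Ties make this an
    inequality. *)
Lemma sum_rank (V : finType) (A : {set V}) (x : V -> R) (F : nat -> R) :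
  {homo F : m n / (m <= n)%N >-> n <= m} ->
  \sum_(v in A) F #|[set u in A | x v <= x u]| <= \sum_(r < #|A|) F r.+1.
Proof.
move=> Fd; move: {2}#|A| (erefl #|A|) => n; elim: n A => [|n IH] A An.
  by rewrite An big_ord0 (cards0_eq An) big_set0.
have [v0 v0A] : exists v, v \in A by apply/set0Pn; rewrite -card_gt0 An.
have [m mA mmin] : exists2 m, m \in A & forall v, v \in A -> x m <= x v.
  case: (@Order.TotalTheory.arg_minP _ R V v0 (mem A) x v0A) => m mA mm.
  by exists m.
have An' : #|A :\ m| = n by move: An; rewrite (cardsD1 m) mA => -[].
rewrite (bigD1 m) //= An big_ord_recr /= addrC lerD //; last first.
  rewrite (_ : [set u in A | _] = A) ?An //.
  by apply/setP => u; rewrite inE; case uA: (u \in A) => //=; rewrite mmin.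
have := IH _ An'; rewrite An' => {}IH; apply: le_trans IH.
rewrite (eq_bigl (fun v => v \in A :\ m)); last by move=> v; rewrite !inE andbC.
apply: ler_sum => v _; apply: Fd; apply: subset_leq_card.
by apply/subsetP => u; rewrite !inE => /andP[/andP[_ ->]].
Qed.

(* The half-open intervals [(c v, c v + d v]] tile [(0, \sum d v]]. *)
Lemma sum_interval (V : eqType) (s : seq V) (d : V -> R) : uniq s ->
  {in s, forall v, 0 <= d v} ->
  exists c : V -> R, forall y, 0 < y <= \sum_(v <- s) d v ->
    exists2 v, v \in s & c v < y <= c v + d v.
Proof.
elim: s => [|a s IH] /=; first by exists (fun=> 0) => y; rewrite big_nil; case: ltP; lra.
move=> /andP[aNs us] d0.
have [c cP] := IH us (fun v vs => d0 v (mem_behead (s := a :: s) vs)).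
exists (fun v => if v == a then 0 else d a + c v) => y.
rewrite big_cons => /andP[y0 ys].
have [ya|ya] := leP y (d a).
  by exists a; rewrite ?mem_head // eqxx y0 add0r ya.
have [|v vs cv] := cP (y - d a); first by apply/andP; split; lra.
exists v; first by rewrite inE vs orbT.
case: eqP vs => [->|_ _]; first by rewrite (negPf aNs).
by move: cv => /andP[? ?]; apply/andP; split; lra.
Qed.

End InverseSqrt.

(** * Probability that a threshold gate varies on a subcube *)

Section RestrictedGate.
Variables (R : realType) (V : finType).
Implicit Types z y : bits V.

Definition varies (T : {set V}) (F : bits V -> bool) z : bool :=
  [exists y : bits V, [forall v, y v ==> (v \in T)] && (F (bxor z y) != F z)].

(** The rank in the sum counts the fixed inputs at least as heavy as [v]: flipping one of them moves
    the fixed sum out of a piece of length [|w v|], as Littlewood-Offord requires. *)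
Lemma varies_bound (g : ltf R V) (T : {set V}) :
  #|[set z | varies T (ltf_eval g) z]|%:R <= #|{: bits V}|%:R *
    \sum_(v in ltf_inputs g :&: T)
      isqrt R #|[set u in ltf_inputs g :\: T |
                 `|ltf_weight g v| <= `|ltf_weight g u|]|.
Proof.
set D := ltf_inputs g; set w := ltf_weight g; set t := ltf_threshold g.
(* The free part of the sum stays between [lo] and [hi], so the gate can vary only if the threshold
   minus the fixed part lies in the half-open interval from [lo] to [hi]. *)
pose lo := \sum_(v in D :&: T) Num.min 0 (w v).
pose hi := \sum_(v in D :&: T) Num.max 0 (w v).
have [c cP] := @sum_interval R V (enum (D :&: T)) (fun v => `|w v|)
  (enum_uniq _) (fun v _ => normr_ge0 _).
have split_sum z : wsum D w z = wsum (D :\: T) w z + wsum (D :&: T) w z.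
  by rewrite /wsum (big_setID T) addrC.
have lohi z : lo <= wsum (D :&: T) w z <= hi.
  apply/andP; split; apply: ler_sum => v _; case: (z v); rewrite ?mulr1 ?mulr0 /=;
  by rewrite ?ge_min ?le_max lexx ?orbT.
have lohiE : \sum_(v <- enum (D :&: T)) `|w v| = hi - lo.
  rewrite -sumrB big_enum /=; apply: eq_bigr => v _.
  by case: (leP 0 (w v)) => ?; [rewrite ger0_norm|rewrite ltr0_norm] => //; lra.
(* The condition [c v < t - lo - s <= c v + |w v|] solved for the fixed sum [s]; the sign change
   moves the closed end to the left, which is the form [littlewood_offord] takes. *)
pose ev v := [set z | t - lo - c v - `|w v| <= wsum (D :\: T) w z
                        < t - lo - c v - `|w v| + `|w v|].
have sub : [set z | varies T (ltf_eval g) z] \subset \bigcup_(v in D :&: T) ev v.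
  apply/subsetP => z; rewrite inE => /existsP[y /andP[/forallP yT ne]].
  have same : wsum (D :\: T) w (bxor z y) = wsum (D :\: T) w z.
    apply: eq_bigr => v; rewrite inE ffunE => /andP[/negP vT _].
    by move/implyP: (yT v); case: (y v) => [/(_ isT)//|_]; rewrite addbF.
  have [|v vs vy] := cP (t - lo - wsum (D :\: T) w z).
    rewrite lohiE; move: ne (lohi z) (lohi (bxor z y)) same; rewrite /ltf_eval.
    rewrite -/D -/w -/t -!/(wsum _ _ _) !split_sum => ne /andP[? ?] /andP[? ?] e.
    by move: ne; rewrite e; do 2!case: (leP t) => // ?; move=> _; apply/andP; split; lra.
  apply/bigcupP; exists v; first by rewrite mem_enum in vs.
  by rewrite inE; move: vy => /andP[? ?]; apply/andP; split; lra.
apply: (@le_trans _ _ (\sum_(v in D :&: T) #|ev v|%:R)).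
  rewrite -natr_sum ler_nat (leq_trans (subset_leq_card sub)) //.
  elim/big_rec2: _ => [|v m B _ le]; first by rewrite cards0.
  by rewrite (leq_trans (leq_card_setU _ _)) // leq_add2l.
rewrite mulr_sumr; apply: ler_sum => v _.
set A := [set u in _ | _].
have [A0|A0] := posnP #|A|.
  by rewrite A0 /isqrt sqrtr1 invr1 mulr1 ler_nat max_card.
rewrite /isqrt (maxn_idPr A0) ler_pdivlMr ?sqrtr_gt0 ?ltr0n //.
apply: littlewood_offord => //.
  by apply/subsetP => u; rewrite inE => /andP[].
by move=> u; rewrite inE => /andP[].
Qed.

End RestrictedGate.

(** * Random choice of the free variables *)

Section RandomSelection.
Variables (R : realType) (X K N : finType).
Local Notation V := (X + K * N)%type.
Implicit Types (J : {ffun K -> N}) (v : V).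

Definition free_vars J : {set V} := [set inr (i, J i) | i : K].

Definition block_vars : {set V} := [set v | if v is inr _ then true else false].

Lemma mem_free J i j : (inr (i, j) \in free_vars J) = (J i == j).
Proof.
apply/imsetP/eqP => [[i' _ [-> ->]] //|<-].
by exists i.
Qed.

Lemma free_block J : free_vars J \subset block_vars.
Proof. by apply/subsetP => _ /imsetP[i _ ->]; rewrite inE. Qed.

Lemma card_free J : (#|free_vars J| <= #|K|)%N.
Proof. exact: leq_imset_card. Qed.

Definition upd J i c : {ffun K -> N} := [ffun i' => if i' == i then c else J i'].

(** Overwriting coordinate [i] by all values of [N] is injective on [Q], since the old value is
    known to be [j]. Each prescribed coordinate thus costs a factor [#|N|]. *)
Lemma card_fixed_coord (i : K) (j : N) (Q Q' : {set {ffun K -> N}}) :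
  {in Q, forall J, J i = j} -> (forall J c, J \in Q -> upd J i c \in Q') ->
  (#|Q| * #|N| <= #|Q'|)%N.
Proof.
move=> Qi QQ'.
rewrite -cardsT -cardsX.
rewrite -(@card_in_imset _ _ (fun p => upd p.1 i p.2)).
  apply: subset_leq_card; apply/subsetP => _ /imsetP[[J c] /setXP[JQ _] ->].
  exact: QQ'.
move=> [J c] [J' c'] /setXP[/= JQ _] /setXP[/= JQ' _] /ffunP e.
have ec : c = c' by move: (e i); rewrite !ffunE eqxx.
congr pair => //; apply/ffunP => i'; have := e i'; rewrite !ffunE.
by case: eqP => [-> _|//]; rewrite !Qi.
Qed.

Lemma card_free_mem v : v \in block_vars ->
  (#|[set J | v \in free_vars J]| * #|N| <= #|{: {ffun K -> N}}|)%N.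
Proof.
case: v => [x|[i j]]; rewrite inE // => _.
rewrite -[X in (_ <= X)%N]cardsT; apply: (@card_fixed_coord i j) => [J|J c _]; last by rewrite inE.
by rewrite inE mem_free => /eqP.
Qed.

(** Distinct variables of one block are never both free; in different blocks the two events are
    independent. *)
Lemma card_free_mem2 u v : u != v -> u \in block_vars -> v \in block_vars ->
  (#|[set J | (u \in free_vars J) && (v \in free_vars J)]| * #|N| * #|N|
     <= #|{: {ffun K -> N}}|)%N.
Proof.
case: u v => [x|[i j]] [x'|[i' j']]; rewrite ?inE // => ne _ _.
apply: leq_trans (card_free_mem (v := inr (i', j')) _); last by rewrite inE.
rewrite leq_mul2r; apply/orP; right.
apply: (@card_fixed_coord i j) => [J|J c]; rewrite !inE !mem_free.
  by case/andP => /eqP.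
case/andP => /eqP Ji /eqP Ji'; rewrite ffunE; case: (i' =P i) => [ii|_]; last by rewrite Ji'.
by move: ne; rewrite -Ji -Ji' ii eqxx.
Qed.

(** At most [#|K|] variables are free, so once [#|K|] is subtracted from the rank the factor of
    [varies_bound] no longer depends on [J]. What stays random is that [v] is free together with a
    second input, of probability at most [min 1 (w / #|N|) / #|N|]. The factors are then summed by
    [sum_rank] and [sum_isqrt]. *)
Lemma sum_varies (g : ltf R V) (w := #|ltf_inputs g :&: block_vars|) :
  (0 < #|N|)%N ->
  \sum_(J : {ffun K -> N})
    #|[set z | (1 < #|ltf_inputs g :&: free_vars J|)%N &&
               varies (free_vars J) (ltf_eval g) z]|%:R
  <= #|{: {ffun K -> N}}|%:R * #|{: bits V}|%:R *
     (Num.min 1 (w%:R / #|N|%:R) / #|N|%:R *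
       (#|K|%:R + 2 * Num.sqrt w%:R)) :> R.
Proof.
move=> N0; set D := ltf_inputs g; set Da := D :&: block_vars.
set F := #|{: {ffun K -> N}}|; set Z := #|{: bits V}|; set q := Num.min _ _ / _.
have N0' : 0 < #|N|%:R :> R by rewrite ltr0n.
pose rank v := #|[set u in Da | `|ltf_weight g v| <= `|ltf_weight g u|]|.
pose two J := (1 < #|D :&: free_vars J|)%N.
have le1 J : #|[set z | two J && varies (free_vars J) (ltf_eval g) z]|%:R
    <= Z%:R * \sum_(v in Da) ((v \in free_vars J) && two J)%:R * isqrt R (rank v - #|K|).
  case: (boolP (two J)) => tJ; last first.
    rewrite (_ : [set z | _] = set0) ?cards0; last by apply/setP => z; rewrite !inE.
    rewrite mulr_ge0 // sumr_ge0 // => v _; rewrite mulr_ge0 // isqrt_ge0 //.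
  apply: (le_trans (varies_bound g (free_vars J))).
  rewrite ler_wpM2l // -/D.
  have sub : D :&: free_vars J \subset Da by rewrite setIS // free_block.
  rewrite big_mkcond [X in _ <= X]big_mkcond /=; apply: ler_sum => v _.
  case: ifPn => [vDF|_]; last by case: ifP => // _; rewrite mulr_ge0 ?isqrt_ge0.
  rewrite (subsetP sub) //; move: vDF => /setIP[_ ->]; rewrite mul1r.
  apply: isqrt_le; rewrite leq_subLR.
  set A := [set u in D :\: free_vars J | _].
  have sub2 : [set u in Da | `|ltf_weight g v| <= `|ltf_weight g u|] \subset free_vars J :|: A.
    apply/subsetP => u; rewrite !inE => /andP[/andP[uD _] ->]; rewrite uD !andbT.
    by case: (u \in free_vars J).
  apply: (leq_trans (subset_leq_card sub2)); apply: (leq_trans (leq_card_setU _ _)).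
  by rewrite leq_add2r card_free.
have q0 : 0 <= q by rewrite /q mulr_ge0 // ?invr_ge0 // le_min ler01 divr_ge0.
have cnt v : v \in Da -> \sum_J ((v \in free_vars J) && two J)%:R <= F%:R * q.
  move=> vDa; rewrite /q mulrA ler_pdivlMr // minr_pMr // mulr1.
  have vb : v \in block_vars by case/setIP: vDa.
  rewrite le_min; apply/andP; split.
    apply: le_trans (_ : (#|[set J | v \in free_vars J]| * #|N|)%:R <= _).
      rewrite natrM ler_wpM2r // -sum1_card natr_sum [X in _ <= X]big_mkcond /=.
      by apply: ler_sum => J _; rewrite inE; case: (v \in free_vars J) => //=; case: (two J).
    by rewrite ler_nat card_free_mem.
  rewrite mulrA ler_pdivlMr // -!natrM.
  (* Union bound over the second free input [u]. *)
  pose both u := [set J | (u \in free_vars J) && (v \in free_vars J)].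
  apply: le_trans
    (_ : (\sum_(u in Da | u != v) #|both u|)%:R * #|N|%:R * #|N|%:R <= _).
    rewrite !ler_wpM2r // natr_sum.
    under [X in _ <= X]eq_bigr => u _ do rewrite -sum1_card natr_sum big_mkcond /=.
    rewrite exchange_big /=; apply: ler_sum => J _.
    case: (boolP (v \in free_vars J)) => vJ /=; last by rewrite sumr_ge0 // => u _; case: ifP.
    case: (boolP (two J)) => tJ; last by rewrite sumr_ge0 // => u _; case: ifP.
    have [u uDJ uv] : exists2 u, u \in D :&: free_vars J & u != v.
      have /card_gt1P[x [y [xD yD xy]]] := tJ.
      by case: (eqVneq x v) => [xv|]; [exists y; rewrite // eq_sym -xv|exists x].
    have uDa : u \in Da by move: uDJ; apply/subsetP; rewrite setIS ?free_block.
    rewrite (bigD1 u) ?uDa //= inE vJ; case/setIP: uDJ => _ -> /=.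
    by rewrite lerDl sumr_ge0 // => u' _; case: ifP.
  rewrite -!natrM ler_nat !big_distrl /=.
  apply: (@leq_trans (\sum_(u in Da | u != v) F)%N).
    apply: leq_sum => u /andP[/setIP[_ ub] uv]; exact: card_free_mem2.
  rewrite sum_nat_const mulnC leq_mul2l subset_leq_card ?orbT //.
  by apply/subsetP => u /andP[].
apply: (le_trans (ler_sum _ (fun J _ => le1 J))).
rewrite -mulr_sumr exchange_big /= -/q [F%:R * _]mulrC -[X in _ <= X]mulrA ler_wpM2l // mulrA.
apply: (@le_trans _ _ (F%:R * q * \sum_(v in Da) isqrt R (rank v - #|K|))).
  rewrite mulr_sumr; apply: ler_sum => v vDa; rewrite -mulr_suml.
  by rewrite ler_wpM2r ?isqrt_ge0 // cnt.
rewrite ler_wpM2l ?(mulr_ge0 (ler0n _ _) q0) //.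
have := @sum_rank R V Da (fun v => `|ltf_weight g v|) (fun m => isqrt R (m - #|K|)).
move=> /= /(_ (fun m n mn => isqrt_le R (leq_sub2r #|K| mn))) sr.
apply: (le_trans sr).
apply: (le_trans (sum_isqrt R #|K| #|Da|)); rewrite lerD //.
  by rewrite ler_nat geq_minr.
by rewrite ler_wpM2l // ler_wsqrtr // ler_nat leq_subr.
Qed.

End RandomSelection.

Arguments free_vars {X K N} J.
Arguments block_vars {X K N}.

(** * Counting threshold circuits *)

Section Chow.
Variables (R : realType) (X I : finType).
Implicit Types (phi : I -> X -> bool) (h : {ffun X -> bool}).

(** [None] is the constant feature; its Chow parameter is the number of true points and pairs with
    the threshold. *)
Definition feature phi (o : option I) (x : X) : bool :=
  if o is Some i then phi i x else true.

Definition chow phi h : {ffun option I -> 'I_#|X|.+1} :=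
  [ffun o => inord #|[set x | h x && feature phi o x]|].

Definition thresholds phi h : Prop :=
  exists (w : I -> R) (t : R), forall x, h x = (t <= \sum_i w i * (phi i x)%:R).

(* Pairing [h - h'] with the affine form defining [h] gives a sum of nonnegative terms,
   which vanishes when the parameters agree. *)
Lemma chow_inj phi h h' : thresholds phi h -> chow phi h = chow phi h' -> h = h'.
Proof.
move=> [w [t hE]] /ffunP e.
have corr o : \sum_x ((h x)%:R - (h' x)%:R) * (feature phi o x)%:R = 0 :> R.
  have cardE (g : {ffun X -> bool}) : #|[set x | g x && feature phi o x]|%:R
      = \sum_x (g x)%:R * (feature phi o x)%:R :> R.
    rewrite -sum1_card natr_sum big_mkcond /=; apply: eq_bigr => x _.
    by rewrite inE; case: (g x); case: (feature _ _ _); rewrite /= ?mulr1 ?mulr0.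
  under eq_bigr do rewrite mulrBl.
  rewrite sumrB -!cardE; have := congr1 val (e o).
  by rewrite !ffunE /= !inordK ?ltnS ?max_card // => ->; rewrite subrr.
have nn x : 0 <= ((h x)%:R - (h' x)%:R) * (\sum_i w i * (phi i x)%:R - t).
  by rewrite hE; case: (leP t) => ?; case: (h' x) => /=; nra.
have sum0 : \sum_x ((h x)%:R - (h' x)%:R) * (\sum_i w i * (phi i x)%:R - t) = 0.
  under eq_bigr do rewrite mulrBr mulr_sumr.
  rewrite sumrB exchange_big /= big1 => [|i _].
    have := corr None; rewrite /feature -(mulr_suml _ _ _ t).
    by under eq_bigr do rewrite mulr1; move=> ->; rewrite mul0r subrr.
  have := corr (Some i); rewrite /feature => /(congr1 (fun y => w i * y)).
  rewrite mulr0 mulr_sumr => e0; rewrite -[RHS]e0.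
  by apply: eq_bigr => x _; rewrite mulrCA.
(* The affine form is strictly negative where [h] is false, so a vanishing term forces [h'] false
   there. Where [h] is true the form may vanish, so equality has to come from the parameter at
   [None]. *)
have le x : (h' x <= h x)%N.
  have /eqP : ((h x)%:R - (h' x)%:R) * (\sum_i w i * (phi i x)%:R - t) = 0.
    by apply: (psumr_eq0P (fun x _ => nn x) sum0).
  by rewrite hE; case: (leP t) => // lt; case: (h' x) => //= e0; nra.
have nn' x : 0 <= (h x)%:R - (h' x)%:R :> R by rewrite subr_ge0 ler_nat.
apply/ffunP => x.
have : (h x)%:R - (h' x)%:R = 0 :> R.
  apply: (psumr_eq0P (P := xpredT) (fun x _ => nn' x)) => //.
  by have := corr None; rewrite /feature; under eq_bigr do rewrite mulr1.
by case: (h x); case: (h' x) => //=; lra.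
Qed.

Definition of_chow phi (c : {ffun option I -> 'I_#|X|.+1}) : {ffun X -> bool} :=
  odflt [ffun=> false] [pick h | chow phi h == c].

Lemma chowK phi h : thresholds phi h -> of_chow phi (chow phi h) = h.
Proof.
move=> ht; rewrite /of_chow; case: pickP => [h' /eqP e|/(_ h)]; last by rewrite eqxx.
by rewrite (chow_inj ht (esym e)).
Qed.

End Chow.

(** * Number of functions of [k] bits computed by small depth-two circuits *)

Section DepthTwo.
Variables (R : realType) (k : nat).
Implicit Types (S : {set 'I_k}) (h : bits 'I_k -> bool).

Definition lin S (w : 'I_k -> R) (b : bits 'I_k) : R := \sum_(i in S) w i * (b i)%:R.

Definition threshold_on S h : Prop := exists w t, forall b, h b = (t <= lin S w b).

Definition depth2 S (r : nat) h : Prop :=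
  exists2 g : 'I_r -> bits 'I_k -> bool, forall j, threshold_on S (g j) &
    exists w (u : 'I_r -> R) t, forall b,
      h b = (t <= lin S w b + \sum_j u j * (g j b)%:R).

Let bit S (i : 'I_#|S|) (b : bits 'I_k) : bool := b (enum_val i).

Let features S r (G : {ffun 'I_r -> {ffun bits 'I_k -> bool}}) (o : 'I_#|S| + 'I_r) :=
  match o with inl i => bit i | inr j => fun b => G j b end.

Lemma linE S w b : lin S w b = \sum_(i < #|S|) w (enum_val i) * (bit i b)%:R.
Proof. by rewrite /lin big_enum_val. Qed.

(* A circuit is encoded by the Chow parameters of its gates, each in [0 .. 2^k]. *)
Lemma card_depth2 S r : exists H : {set {ffun bits 'I_k -> bool}},
  (#|H| <= (2 ^ k).+1 ^ ((#|S| + 2) * r.+1))%N /\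
  forall h, depth2 S r h -> [ffun b => h b] \in H.
Proof.
pose C1 := {ffun option 'I_#|S| -> 'I_#|{: bits 'I_k}|.+1}.
pose C2 := {ffun option ('I_#|S| + 'I_r) -> 'I_#|{: bits 'I_k}|.+1}.
pose dec (c : {ffun 'I_r -> C1} * C2) :=
  of_chow (@features S r [ffun j => of_chow (@bit S) (c.1 j)]) c.2.
exists [set dec c | c : {ffun 'I_r -> C1} * C2]; split.
  apply: leq_trans (leq_imset_card _ _) _.
  (* There are [#|S| + 1] parameters for each of the [r] bottom gates and [#|S| + r + 1] for the
     output gate, one less in total than the exponent claimed. *)
  rewrite card_prod !card_ffun !card_option !card_sum !card_ord card_bool -expnM -expnD.
  by rewrite leq_exp2l; lia.
move=> h [g gT [w [u [t hE]]]].
have gT' j : thresholds R (@bit S) [ffun b => g j b].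
  have [v [s gE]] := gT j; exists (fun i => v (enum_val i)), s => b.
  by rewrite ffunE gE linE.
pose G := [ffun j => [ffun b => g j b]] : {ffun 'I_r -> {ffun bits 'I_k -> bool}}.
have hT : thresholds R (@features S r G) [ffun b => h b].
  exists (fun o : 'I_#|S| + 'I_r =>
    match o with inl i => w (enum_val i) | inr j => u j end), t => b.
  rewrite ffunE hE big_sumType /= linE; congr (_ <= _ + _).
  by apply: eq_bigr => j _; rewrite !ffunE.
apply/imsetP.
exists ([ffun j => chow (@bit S) (G j)], chow (@features S r G) [ffun b => h b]) => //.
rewrite /dec /= -[LHS](chowK hT); congr (of_chow (features _) _).
by apply/ffunP => j; rewrite [RHS]ffunE /= [in RHS]ffunE !(ffunE _ j) (chowK (gT' j)).
Qed.

End DepthTwo.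

(** * Andreev's function on a random subcube *)

Section Andreev.
Variables (R : realType) (k : nat).
Local Notation V := (andreev_var k).
Local Notation N := (2 ^ k %/ k)%N.
Implicit Types (z : bits V) (J : {ffun 'I_k -> 'I_N}) (b : bits 'I_k).

(** Serves as an xor mask: [bxor z (embed J b)] runs over the subcube through [z], with [b] telling
    which free variables are flipped. *)
Definition embed J b : bits V :=
  [ffun v => match v with inl _ => false | inr (i, j) => (j == J i) && b i end].

Definition embed_data (y : bits 'I_(2 ^ k)) : bits V :=
  [ffun v => match v with inl p => y p | inr _ => false end].

Definition parities z : bits 'I_k :=
  [ffun i : 'I_k => odd (\sum_(j < N) z (inr (i, j)))].

Lemma andreevE z : andreev z = z (inl (bin (parities z))).
Proof. by rewrite /andreev /multiplexer ffunE. Qed.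

(** Each block holds exactly one free variable, and flipping it toggles the parity of that block
    alone. *)
Lemma parities_embed z J b : parities (bxor z (embed J b)) = bxor (parities z) b.
Proof.
apply/ffunP => i; rewrite !ffunE (bigD1 (J i)) //= [in RHS](bigD1 (J i)) //=.
rewrite !oddD !ffunE eqxx /= !oddb addbAC; congr (_ (+) odd _ (+) _).
by apply: eq_bigr => j /negPf ji; rewrite !ffunE ji addbF.
Qed.

Lemma parities_embed_data z y : parities (bxor z (embed_data y)) = parities z.
Proof.
apply/ffunP => i; rewrite !ffunE; congr odd.
by apply: eq_bigr => j _; rewrite !ffunE addbF.
Qed.

Lemma andreev_embed z J b :
  andreev (bxor z (embed J b)) = z (inl (bin (bxor (parities z) b))).
Proof. by rewrite andreevE parities_embed !ffunE addbF. Qed.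

Let sg (c : bool) : R := if c then 1 else -1.

(** A product substitute for the exponential moment of the number of agreements: a factor [1 + d]
    for each agreement and [1 - d] for each disagreement. *)
Definition bias_weight (d : R) (h : bits 'I_k -> bool) J z : R :=
  \prod_b (1 + d * sg (h b == andreev (bxor z (embed J b)))).

Lemma card_bits_data : #|{: bits 'I_k}| = (2 ^ k)%N.
Proof. by rewrite card_ffun card_bool card_ord. Qed.

(* Averaging over the data bits first: they are independent, and each factor has
   mean 1. *)
Lemma sum_bias_weight d h J : \sum_z bias_weight d h J z = #|{: bits V}|%:R.
Proof.
have avg z : \sum_(y : bits 'I_(2 ^ k)) bias_weight d h J (bxor z (embed_data y))
    = #|{: bits 'I_(2 ^ k)}|%:R.
  have [g gK Kg] := bin_bij k.
  have binj : bijective (fun b : bits 'I_k => bin (bxor (parities z) b)).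
    exists (fun p => bxor (parities z) (g p)) => [b|p]; rewrite ?gK.
      by apply/ffunP => i; rewrite !ffunE addKb.
    rewrite -[RHS]Kg; congr bin.
    by apply/ffunP => i; rewrite !ffunE addKb.
  pose G p c := 1 + d * sg (h (bxor (parities z) (g p)) == z (inl p) (+) c).
  transitivity (\sum_(y : {ffun 'I_(2 ^ k) -> bool}) \prod_p G p (y p)).
    apply: eq_bigr => y _; rewrite [RHS](reindex _ (onW_bij _ binj)) /=.
    apply: eq_bigr => b _; rewrite /G andreev_embed parities_embed_data gK !ffunE.
    congr (1 + d * sg (h _ == _)).
    by apply/ffunP => i; rewrite !ffunE addKb.
  (* Distinct [b] read distinct data bits, so the sum over truth tables factors; each bit
     contributes [(1 + d) + (1 - d) = 2]. *)
  rewrite -bigA_distr_bigA /= card_ffun card_bool card_ord natrX.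
  rewrite -[in RHS](card_ord (2 ^ k)) -prodr_const; apply: eq_bigr => p _.
  rewrite big_bool /G /sg addbT addbF.
  by case: (h _); case: (z _) => /=; ring.
have M0 : #|{: bits 'I_(2 ^ k)}|%:R != 0 :> R.
  by rewrite pnatr_eq0 card_ffun card_bool expn_eq0.
apply: (mulfI M0).
transitivity (\sum_(y : bits 'I_(2 ^ k)) \sum_z bias_weight d h J (bxor z (embed_data y))).
  under [RHS]eq_bigr do rewrite sum_bxor.
  by rewrite sumr_const mulr_natl.
by rewrite exchange_big /=; under eq_bigr do rewrite avg; rewrite sumr_const mulr_natr.
Qed.

(** Bounding the inverse exponential below by [1 - u + 2 u^2] reduces this to [(1 + u) (1 - u + 2
    u^2) = 1 + u^2 (1 + 2 u) >= 1]. *)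
Lemma expR_le_1Dx (u : R) : `|u| <= 1 / 2 -> expR (u - 2 * u ^+ 2) <= 1 + u.
Proof.
rewrite ler_norml => /andP[u1 u2].
have e := expR_ge1Dx (- (u - 2 * u ^+ 2)).
have p := expR_gt0 (u - 2 * u ^+ 2).
have m : expR (u - 2 * u ^+ 2) * expR (- (u - 2 * u ^+ 2)) = 1.
  by rewrite -expRD subrr expR0.
rewrite -(@ler_pM2r _ (expR (- (u - 2 * u ^+ 2)))) ?expR_gt0 // m.
by nra.
Qed.

Definition hits (h : bits 'I_k -> bool) J z : {set bits 'I_k} :=
  [set b | h b == andreev (bxor z (embed J b))].

(** Markov's inequality for [bias_weight] with [d = eps / 4]. On the event the signs sum to more
    than [eps 2^k], so the weight is at least the exponential of [(eps^2 / 4 - 2 (eps / 4)^2) 2^k =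
    eps^2 2^k / 8]. *)
Lemma tail_bound (eps : R) h J : 0 <= eps <= 1 ->
  #|[set z | (1 + eps) / 2 * (2 ^ k)%:R < #|hits h J z|%:R]|%:R
  <= #|{: bits V}|%:R * expR (- (eps ^+ 2 * (2 ^ k)%:R / 8)).
Proof.
move=> /andP[e0 e1]; set E := [set z | _].
rewrite expRN ler_pdivlMr ?expR_gt0 // -(sum_bias_weight (eps / 4) h J).
rewrite -sum1_card natr_sum mulr_suml big_mkcond /=.
apply: ler_sum => z _; have W0 : 0 <= bias_weight (eps / 4) h J z.
  by apply: prodr_ge0 => b _; rewrite /sg; case: ifP => _; lra.
case: ifP => // zE; rewrite mul1r.
have le : \prod_b expR (eps / 4 * sg (h b == andreev (bxor z (embed J b)))
     - 2 * (eps / 4) ^+ 2) <= bias_weight (eps / 4) h J z.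
  apply: ler_prod => b _; rewrite expR_ge0 /=.
  set s := sg _; have -> : (eps / 4) ^+ 2 = (eps / 4 * s) ^+ 2.
    by rewrite /s /sg; case: ifP => _; ring.
  apply: expR_le_1Dx; rewrite ler_norml /s /sg; case: ifP => _; lra.
apply: le_trans le; rewrite -expR_sum ler_expR sumrB sumr_const card_bits_data.
rewrite -mulr_sumr.
have -> : \sum_b sg (h b == andreev (bxor z (embed J b))) = 2 * #|hits h J z|%:R - (2 ^ k)%:R.
  transitivity (\sum_b (2 * (b \in hits h J z)%:R - 1 : R)).
    by apply: eq_bigr => b _; rewrite inE /sg; case: (h b == _) => /=; ring.
  rewrite sumrB sumr_const card_bits_data -mulr_sumr; congr (2 * _ - _).
  rewrite -[in RHS]sum1_card natr_sum [RHS]big_mkcond.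
  by apply: eq_bigr => b _; case: ifP.
move: zE; rewrite inE -[(_ *+ _)]mulr_natl; set M := (2 ^ k)%:R; set A := _%:R; nra.
Qed.

(** Outside [Bad] the restriction of [f] is one of the functions counted by [card_depth2]; a union
    bound of [tail_bound] over them adds a second exceptional set of density below [eps / 4]. *)
Lemma agreement_lt (f : bits V -> bool) J S r (eps : R) (Bad : {set bits V}) :
  0 < eps <= 1 ->
  (forall z, z \notin Bad -> depth2 R S r (fun b => f (bxor z (embed J b)))) ->
  #|Bad|%:R <= eps / 4 * #|{: bits V}|%:R ->
  ((2 ^ k).+1 ^ ((#|S| + 2) * r.+1))%:R * expR (- (eps ^+ 2 * (2 ^ k)%:R / 8))
    < eps / 4 ->
  agreement R f (@andreev k) < 1 / 2 + eps.
Proof.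
move=> /andP[e0 e1] good Bad_le small.
have [H [Hc HP]] := card_depth2 R S r.
set Z := #|{: bits V}| in Bad_le *; set M := (2 ^ k)%N in small.
set e := expR _ in small.
have Z0 : 0 < Z%:R :> R by rewrite ltr0n /Z card_ffun card_bool expn_gt0.
have M0 : 0 < M%:R :> R by rewrite ltr0n expn_gt0.
pose tail (h : {ffun bits 'I_k -> bool}) :=
  [set z | (1 + eps) / 2 * M%:R < #|hits h J z|%:R].
pose Bad' := \bigcup_(h in H) tail h.
have Bad'_lt : #|Bad'|%:R < eps / 4 * Z%:R.
  apply: (@le_lt_trans _ _ (#|H|%:R * (Z%:R * e))).
    apply: (@le_trans _ _ (\sum_(h in H) #|tail h|%:R)).
      rewrite -natr_sum ler_nat /Bad'.
      elim/big_rec2: _ => [|v m B _ le]; first by rewrite cards0.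
      by rewrite (leq_trans (leq_card_setU _ _)) // leq_add2l.
    rewrite mulr_natl -sumr_const; apply: ler_sum => h _.
    by apply: tail_bound; rewrite e1 ltW.
  rewrite mulrCA mulrC ltr_pM2r //; apply: le_lt_trans small.
  by rewrite ler_wpM2r ?expR_ge0 // ler_nat.
rewrite /agreement -/Z ltr_pdivrMr //.
rewrite -(ltr_pM2l M0).
(* Double counting: for each fixed [b], xor with [embed J b] permutes the inputs. *)
have -> : M%:R * #|[set a | f a == andreev a]|%:R
    = \sum_z #|hits (fun b => f (bxor z (embed J b))) J z|%:R :> R.
  under [RHS]eq_bigr => z _ do rewrite -sum1_card natr_sum big_mkcond /=.
  rewrite exchange_big /=.
  transitivity (\sum_(b : bits 'I_k) #|[set a | f a == andreev a]|%:R : R).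
    by rewrite sumr_const card_bits_data mulr_natl.
  apply: eq_bigr => b _; rewrite -sum1_card natr_sum big_mkcond /=.
  rewrite -(sum_bxor _ (embed J b)).
  by apply: eq_bigr => z _; rewrite !inE.
(* The budget is [(1 + eps) / 2] for ordinary inputs plus [eps / 4] for each exceptional set, on
   which all [2^k] points may agree. *)
apply: (@le_lt_trans _ _ (\sum_z ((1 + eps) / 2 * M%:R
     + M%:R * ((z \in Bad)%:R + (z \in Bad')%:R)))).
  apply: ler_sum => z _.
  have leM : #|hits (fun b => f (bxor z (embed J b))) J z|%:R <= M%:R :> R.
    by rewrite ler_nat /M -card_bits_data max_card.
  case: (boolP (z \in Bad)) => [_|zB]; first by case: (z \in Bad') => /=; nra.
  case: (boolP (z \in Bad')) => [_|zB'] /=; first by nra.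
  rewrite addr0 mulr0 addr0 leNgt; apply: contra zB' => lt.
  apply/bigcupP; exists [ffun b => f (bxor z (embed J b))]; first exact/HP/good.
  rewrite inE (_ : hits _ _ _ = hits (fun b => f (bxor z (embed J b))) J z) //.
  by apply/setP => b; rewrite !inE ffunE.
rewrite big_split /= sumr_const -mulr_natl -mulr_sumr big_split /= -/Z.
have cardE (B : {set bits V}) : \sum_z (z \in B)%:R = #|B|%:R :> R.
  by rewrite -sum1_card natr_sum [RHS]big_mkcond; apply: eq_bigr => z _; case: ifP.
rewrite !cardE; nra.
Qed.

End Andreev.

(** * Restricted circuits *)

Section RestrictedCircuit.
Variables (R : realType) (k : nat).
Local Notation V := (andreev_var k).
Local Notation N := (2 ^ k %/ k)%N.
Implicit Types (z : bits V) (J : {ffun 'I_k -> 'I_N}) (b : bits 'I_k).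
Implicit Types (S : {set 'I_k}) (g : ltf R V).

Definition live_inputs (D : {set V}) J : {set 'I_k} := [set i | inr (i, J i) \in D].

Lemma card_live_inputs (D : {set V}) J : #|live_inputs D J| = #|D :&: free_vars J|.
Proof.
rewrite -(card_imset (mem (live_inputs D J)) (f := fun i => inr (i, J i) : V)).
  apply: eq_card => v; apply/imsetP/setIP => [[i iL ->]|[vD /imsetP[i _ e]]].
    by move: iL; rewrite inE => ->; split=> //; apply/imsetP; exists i.
  by exists i => //; rewrite inE -e.
by move=> i i' [].
Qed.

Lemma embed_free J b v : embed J b v -> v \in free_vars J.
Proof.
rewrite ffunE; case: v => // -[i j] /andP[/eqP -> _].
by apply/imsetP; exists i.
Qed.

Lemma linS (T S : {set 'I_k}) (w : 'I_k -> R) b : T \subset S ->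
  lin T w b = lin S (fun i => if i \in T then w i else 0) b.
Proof.
move=> TS; rewrite /lin big_mkcond [RHS]big_mkcond; apply: eq_bigr => i _.
case: ifP => [/(subsetP TS) -> //|_]; by case: ifP; rewrite ?mul0r.
Qed.

(** On bits, [z (+) c = z + (1 - 2 z) c], so a weighted sum on the subcube is affine in [b]. *)
Lemma wsum_embed (D : {set V}) (w : V -> R) z J b :
  wsum D w (bxor z (embed J b)) = wsum D w z +
  lin (live_inputs D J) (fun i => w (inr (i, J i)) * (1 - 2 * (z (inr (i, J i)))%:R)) b.
Proof.
have -> : wsum D w (bxor z (embed J b)) = wsum D w z +
    \sum_(v in D) w v * (1 - 2 * (z v)%:R) * (embed J b v)%:R.
  rewrite /wsum -big_split /=; apply: eq_bigr => v _; rewrite [bxor _ _ v]ffunE.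
  by case: (z v); case: (embed J b v) => /=; ring.
congr (_ + _); rewrite (big_setID (free_vars J)) /= [X in _ + X]big1 ?addr0; last first.
  move=> v /setDP[_]; have := @embed_free J b v; case: (embed J b v) => [->|_] //.
  by rewrite mulr0.
have -> : D :&: free_vars J = [set (inr (i, J i) : V) | i in live_inputs D J].
  apply/setP => v; apply/setIP/imsetP => [[vD /imsetP[i _ e]]|[i iL ->]].
    by exists i => //; rewrite inE -e.
  by move: iL; rewrite inE => ->; split=> //; apply/imsetP; exists i.
rewrite big_imset /=; last by move=> i i' _ _ [].
by apply: eq_bigr => i _; rewrite ffunE eqxx.
Qed.

Lemma gate_embed g z J : exists (w : 'I_k -> R) (t : R), forall b,
  ltf_eval g (bxor z (embed J b)) = (t <= lin (live_inputs (ltf_inputs g) J) w b).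
Proof.
pose a := wsum (ltf_inputs g) (ltf_weight g) z.
eexists _, (ltf_threshold g - a) => b.
by rewrite /ltf_eval -/(wsum _ _ _) wsum_embed -/a lerBlDl.
Qed.

Lemma gate_threshold_on g z J S : live_inputs (ltf_inputs g) J \subset S ->
  threshold_on R S (fun b => ltf_eval g (bxor z (embed J b))).
Proof.
move=> sub; have [w [t gE]] := gate_embed g z J.
by eexists _, t => b; rewrite gE (linS _ _ sub).
Qed.

Definition affine_on S (h : bits 'I_k -> bool) : Prop :=
  exists (a : R) w, forall b, (h b)%:R = a + lin S w b.

Lemma affine_const S (h : bits 'I_k -> bool) c : (forall b, h b = c) -> affine_on S h.
Proof.
move=> hc; exists c%:R, (fun=> 0) => b.
by rewrite hc /lin big1 ?addr0 // => i _; rewrite mul0r.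
Qed.

(** A Boolean function of at most one bit is affine, with its value at 0 as constant and the
    difference of its two values as slope. *)
Lemma affine_gate1 g z J S : live_inputs (ltf_inputs g) J \subset S ->
  (#|live_inputs (ltf_inputs g) J| <= 1)%N ->
  affine_on S (fun b => ltf_eval g (bxor z (embed J b))).
Proof.
have [w [t gE]] := gate_embed g z J.
move: gE; set T := live_inputs _ _ => gE TS.
case: (posnP #|T|) => [/cards0_eq T0 _|T0 T1].
  by apply: (@affine_const _ _ (t <= 0)) => b; rewrite gE T0 /lin big_set0.
have /cards1P[i Ti] : #|T| == 1%N by rewrite eqn_leq T1 T0.
exists (t <= 0)%R%:R, (fun i' => if i' == i then (t <= w i)%R%:R - (t <= 0)%R%:R else 0) => b.
rewrite gE Ti /lin big_set1 (bigD1 i) ?(subsetP TS) ?Ti ?inE //= eqxx big1 => [|j].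
  by case: (b i); rewrite ?mulr1 ?mulr0 ?addr0 //= addrCA subrr addr0.
by move=> /andP[_ /negPf ->]; rewrite mul0r.
Qed.

Lemma affine_not_varies g z J S : ~~ varies (free_vars J) (ltf_eval g) z ->
  affine_on S (fun b => ltf_eval g (bxor z (embed J b))).
Proof.
move=> nv; apply: (@affine_const _ _ (ltf_eval g z)) => b.
apply/eqP; apply: contraR nv => ne; apply/existsP; exists (embed J b).
by rewrite ne andbT; apply/forallP => v; apply/implyP/embed_free.
Qed.

(** Lists at most [r] live gates in exactly [r] slots, as [depth2] expects. One listing [p] serves
    all [F], and empty slots contribute 0. *)
Lemma sum_pad (T : finType) (A : {set T}) r : (#|A| <= r)%N ->
  exists p : 'I_r -> option T, forall F : T -> R,
    \sum_(j in A) F j = \sum_i oapp F 0 (p i).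
Proof.
elim: r A => [|r IH] A Ar.
  exists (fun=> None) => F; rewrite big_ord0; move: Ar; rewrite leqn0 => /eqP /cards0_eq ->.
  by rewrite big_set0.
case: (set_0Vmem A) => [->|[a aA]].
  by exists (fun=> None) => F; rewrite big_set0 big1.
have [|p pE] := IH (A :\ a); first by move: Ar; rewrite (cardsD1 a) aA.
exists (fun i => if unlift ord0 i is Some i' then p i' else Some a) => F.
rewrite big_ord_recl unlift_none (bigD1 a) //=; congr (_ + _).
under [RHS]eq_bigr do rewrite liftK.
by rewrite -pE; apply: eq_bigl => j; rewrite !inE andbC.
Qed.

Variable C : ltf_ltf R V.
Let m := bottom_size C.
Let top_vars : {set V} := [set v | inl v \in ltf_inputs (output_gate C)].

Lemma circuit_depth2 J z S r (L : {set 'I_m}) :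
  (forall j, live_inputs (ltf_inputs (bottom_gate (l := C) j)) J \subset S) ->
  live_inputs top_vars J \subset S ->
  (#|L| <= r)%N ->
  (forall j, j \notin L ->
     affine_on S (fun b => ltf_eval (bottom_gate (l := C) j) (bxor z (embed J b)))) ->
  depth2 R S r (fun b => circuit_eval C (bxor z (embed J b))).
Proof.
move=> bS tS Lr La.
pose G j b := ltf_eval (bottom_gate (l := C) j) (bxor z (embed J b)).
have /fin_all_exists[a aP] : forall j, exists a : R * ('I_k -> R),
    j \notin L -> forall b, (G j b)%:R = a.1 + lin S a.2 b.
  move=> j; case: (boolP (j \in L)) => [_|/La [a0 [w0 aw]]]; first by exists (0, fun=> 0).
  by exists (a0, w0) => _.
pose W := ltf_weight (output_gate C); pose t := ltf_threshold (output_gate C).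
pose wires j : bool := inr j \in ltf_inputs (output_gate C).
pose w1 j : R := if wires j then W (inr j) else 0.
have [p pE] := sum_pad Lr.
exists (fun i b => oapp (fun j => G j b) false (p i)).
  move=> i; case: (p i) => [j|] /=; first exact: gate_threshold_on.
  (* An empty slot becomes the constant false gate: zero weights under threshold 1. *)
  exists (fun=> 0), 1 => b; rewrite /lin big1 => [|i' _]; last by rewrite mul0r.
  by rewrite ler10.
pose w0 (i : 'I_k) := if i \in live_inputs top_vars J
  then W (inl (inr (i, J i))) * (1 - 2 * (z (inr (i, J i)))%:R) else 0.
exists (fun i => w0 i + \sum_(j | j \notin L) w1 j * (a j).2 i).
exists (fun i => oapp w1 0 (p i)).
(* The new threshold absorbs the direct inputs at the base point [z] and the constants of the affine
   gates; their slopes have gone into the bit weights. *)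
exists (t - wsum top_vars (fun v => W (inl v)) z - \sum_(j | j \notin L) w1 j * (a j).1) => b.
rewrite /circuit_eval /ltf_eval -/t -/W big_mkcond big_sumType /=.
have -> : \sum_(v : V) (if inl v \in ltf_inputs (output_gate C) then W (inl v) *
     ([ffun v => match v with inl i => bxor z (embed J b) i
       | inr j => G j b end] (inl v))%:R else 0)
   = wsum top_vars (fun v => W (inl v)) z + lin S w0 b.
  rewrite -(linS (fun i => W (inl (inr (i, J i))) * (1 - 2 * (z (inr (i, J i)))%:R)) b tS).
  rewrite -(wsum_embed _ (fun v => W (inl v))) /wsum [RHS]big_mkcond /=.
  by apply: eq_bigr => v _; rewrite inE ffunE.
have -> : \sum_(j < m) (if inr j \in ltf_inputs (output_gate C) then W (inr j) *
     ([ffun v => match v with inl i => bxor z (embed J b) i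
       | inr j => G j b end] (inr j))%:R else 0)
   = \sum_(j | j \notin L) w1 j * (a j).1
     + lin S (fun i => \sum_(j | j \notin L) w1 j * (a j).2 i) b
     + \sum_i oapp w1 0 (p i) * (oapp (fun j => G j b) false (p i))%:R.
  transitivity (\sum_j w1 j * (G j b)%:R).
    by apply: eq_bigr => j _; rewrite ffunE /w1 /wires; case: ifP; rewrite ?mul0r.
  rewrite (bigID (mem L)) /= addrC; congr (_ + _).
    rewrite /lin; under [X in _ = _ + X]eq_bigr do rewrite mulr_suml.
    rewrite exchange_big -big_split /=; apply: eq_bigr => j jL.
    rewrite aP // mulrDr /lin mulr_sumr; congr (_ + _).
    by apply: eq_bigr => i _; rewrite mulrA.
  rewrite pE; apply: eq_bigr => i _; case: (p i) => //=; by rewrite mul0r.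
have -> : lin S (fun i => w0 i + \sum_(j | j \notin L) w1 j * (a j).2 i) b
  = lin S w0 b + lin S (fun i => \sum_(j | j \notin L) w1 j * (a j).2 i) b.
  by rewrite /lin -big_split; apply: eq_bigr => i _; rewrite mulrDl.
set A := wsum _ _ _; set B := lin _ _ _; set D := \sum_(j | _) _; set E := lin _ _ _.
by set F := \sum_i _; rewrite !lerBlDr; congr (_ <= _); ring.
Qed.

End RestrictedCircuit.

(** * Agreement bounds from few live gates and from few wires *)

Section Regimes.
Variables (R : realType) (k : nat).
Local Notation V := (andreev_var k).
Local Notation N := (2 ^ k %/ k)%N.
Variables (C : ltf_ltf R V) (f : bits V -> bool) (eps : R).
Hypotheses (N0 : (0 < N)%N) (Cf : computes C f) (eps01 : 0 < eps <= 1).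
Let m := bottom_size C.
Let gate : 'I_m -> ltf R V := bottom_gate (l := C).
Let D j := ltf_inputs (gate j).

Definition small_count (s r : nat) : Prop :=
  ((2 ^ k).+1 ^ ((s + 2) * r.+1))%:R * expR (- (eps ^+ 2 * (2 ^ k)%:R / 8)) < eps / 4.

(** The bound of [sum_varies] as a probability over [J] and [z], for a gate with [w] inputs among
    the block variables. *)
Definition live_bound (w : nat) : R :=
  Num.min 1 (w%:R / N%:R) / N%:R * (k%:R + 2 * Num.sqrt w%:R).

Let selection : finType := {ffun 'I_k -> 'I_N}.

Let live_gates (J : selection) z : {set 'I_m} := [set j |
  (1 < #|D j :&: free_vars J|)%N && varies (free_vars J) (ltf_eval (gate j)) z].

(** Averaging fixes a [J] for which the mean number of live gates over [z] is at most [B]. By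
    Markov's inequality more than [r] gates are live on at most a [B / (r + 1)] fraction of inputs,
    which form [Bad]. *)
Lemma few_live_gates_agreement (r : nat) (B : R) :
  \sum_j live_bound #|D j :&: block_vars| <= B ->
  B <= eps / 4 * r.+1%:R -> small_count k r ->
  agreement R f (@andreev k) < 1 / 2 + eps.
Proof.
move=> sumB Br small.
set F := #|selection|; set Z := #|{: bits V}|.
have F0 : 0 < F%:R :> R.
  by rewrite ltr0n /F card_ffun expn_gt0 card_ord N0.
have double : \sum_(J : selection) \sum_z #|live_gates J z|%:R <= F%:R * (Z%:R * B).
  under eq_bigr => J _.
    under eq_bigr => z _ do rewrite -sum1_card natr_sum big_mkcond /=.
    rewrite exchange_big /=.
    over.
  rewrite exchange_big /=; apply: le_trans
    (_ : F%:R * (Z%:R * \sum_j live_bound #|D j :&: block_vars|) <= _); last first.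
    by rewrite !ler_wpM2l.
  rewrite mulrA mulr_sumr; apply: ler_sum => j _.
  have := @sum_varies R 'I_(2 ^ k) 'I_k 'I_N (gate j); rewrite !card_ord => /(_ N0).
  apply: le_trans; apply: ler_sum => J _.
  rewrite -sum1_card natr_sum [X in _ <= X]big_mkcond /=; apply: ler_sum => z _.
  by rewrite !inE.
have [J JP] : exists J : selection, \sum_z #|live_gates J z|%:R <= Z%:R * B.
  case: (pickP (fun J : selection => \sum_z #|live_gates J z|%:R <= Z%:R * B)) => [J|none].
    by exists J.
  have FE : F%:R * (Z%:R * B) = \sum_(J : selection) Z%:R * B.
    by rewrite sumr_const mulr_natl.
  move: double; rewrite leNgt FE => /negP[]; apply: ltr_sum => [|J _].
    by apply/hasP; exists [ffun=> Ordinal N0]; rewrite ?mem_index_enum.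
  by rewrite ltNge none.
pose Bad := [set z | (r < #|live_gates J z|)%N].
apply: (@agreement_lt R k f J [set: 'I_k] r eps Bad) => //.
- move=> z; rewrite inE -leqNgt => Lr.
  have := @circuit_depth2 R k C J z [set: 'I_k] r (live_gates J z).
  have fE : (fun b => f (bxor z (embed J b))) =1
            (fun b => circuit_eval C (bxor z (embed J b))).
    by move=> b; rewrite Cf.
  case=> [j||//|j jL|g gT [w [u [t hE]]]]; rewrite ?subsetT //; last first.
    by exists g => //; exists w, u, t => b; rewrite fE hE.
  move: jL; rewrite inE negb_and -leqNgt -card_live_inputs => /orP[le1|nv].
    by apply: affine_gate1 => //; exact: subsetT.
  exact: affine_not_varies.
- have r0 : 0 < r.+1%:R :> R by rewrite ltr0n.
  rewrite -(ler_pM2r r0); apply: (@le_trans _ _ (\sum_z #|live_gates J z|%:R)).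
    rewrite -natrM -natr_sum ler_nat -sum1_card big_distrl [leqLHS]big_mkcond /=.
    by apply: leq_sum => z _; case: ifP => //; rewrite inE mul1n.
  apply: (le_trans JP); rewrite mulrAC mulrC ler_wpM2r //.
by rewrite cardsT card_ord.
Qed.

Let top_vars : {set V} := [set v | inl v \in ltf_inputs (output_gate C)].

Let fan_out v : nat := (\sum_j (v \in D j) + (v \in top_vars))%N.

Lemma sum_fan_out : (\sum_v fan_out v <= wires C)%N.
Proof.
rewrite /fan_out big_split /= exchange_big /= leq_add //.
  apply: leq_sum => j _; rewrite -big_mkcond sum1_card /fan_in //.
rewrite -big_mkcond sum1_card /fan_in -(card_imset (mem top_vars) (f := inl : V -> V + 'I_m)).
  by apply: subset_leq_card; apply/subsetP => _ /imsetP[v vt ->]; rewrite inE in vt.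
by move=> v v' [].
Qed.

(** The least fan-out in a block is at most the average over its [N] variables, so the chosen
    variables have total fan-out at most [r]. This bounds both the number of free bits still read
    and the number of bottom gates reading them, on every input, so [Bad] is empty. *)
Lemma few_wires_agreement :
  small_count (wires C %/ N) (wires C %/ N) -> agreement R f (@andreev k) < 1 / 2 + eps.
Proof.
set r := (_ %/ _)%N => small.
have /fin_all_exists[J0 J0P] : forall i : 'I_k, exists j : 'I_N,
    forall j', (fan_out (inr (i, j)) <= fan_out (inr (i, j')))%N.
  move=> i; case: (@arg_minnP _ (Ordinal N0) xpredT (fun j => fan_out (inr (i, j)))) => // j _ jP.
  by exists j => j'; apply: jP.
pose J : selection := [ffun i => J0 i].
pose Phi := (\sum_i fan_out (inr (i, J i)))%N.
have Phir : (Phi <= r)%N.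
  rewrite /r leq_divRL // (leq_trans _ sum_fan_out) // [leqRHS]big_sumType /=.
  rewrite (leq_trans _ (leq_addl _ _)) // big_distrl /=.
  rewrite (eq_bigr (fun p => fan_out (inr (p.1, p.2)))); last by case.
  rewrite -(pair_bigA _ (fun i j => fan_out (inr (i, j)))) /=.
  apply: leq_sum => i _; rewrite -[leqLHS]mulnC -{1}(card_ord N) -sum_nat_const.
  by apply: leq_sum => j _; rewrite ffunE.
pose S := [set i | 0 < fan_out (inr (i, J i))]%N.
pose L : {set 'I_m} := [set j | live_inputs (D j) J != set0].
have Sr : (#|S| <= r)%N.
  apply: leq_trans Phir; rewrite -sum1_card big_mkcond; apply: leq_sum => i _.
  by rewrite inE; case: ifP.
have Lr : (#|L| <= r)%N.
  apply: leq_trans Phir; apply: (@leq_trans (\sum_j #|live_inputs (D j) J|)%N).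
    rewrite -sum1_card big_mkcond; apply: leq_sum => j _.
    by rewrite inE; case: ifP => //; rewrite card_gt0.
  under eq_bigr => j _ do rewrite -sum1_card big_mkcond /=.
  rewrite exchange_big; apply: leq_sum => i _; rewrite /fan_out.
  by rewrite (leq_trans _ (leq_addr _ _)) // leq_sum // => j _; rewrite inE.
have bS j : live_inputs (D j) J \subset S.
  apply/subsetP => i; by rewrite !inE /fan_out (bigD1 j) //= => ->.

apply: (@agreement_lt R k f J S r eps set0) => //.
- move=> z _; have := @circuit_depth2 R k C J z S r L bS.
  have fE : (fun b => f (bxor z (embed J b))) =1
            (fun b => circuit_eval C (bxor z (embed J b))).
    by move=> b; rewrite Cf.
  case=> [|//|j jL|g gT [w [u [t hE]]]]; last first.
  + by exists g => //; exists w, u, t => b; rewrite fE hE.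
  + apply: affine_gate1; first exact: bS.
    by move: jL; rewrite inE negbK => /eqP ->; rewrite cards0.
  by apply/subsetP => i; rewrite !inE /fan_out inE => ->; rewrite addn_gt0 orbT.
- by rewrite cards0 mulr_ge0 // ?ler0n // divr_ge0 //; case/andP: eps01 => /ltW.
apply: le_lt_trans small; rewrite ler_wpM2r ?expR_ge0 // ler_nat leq_exp2l; last first.
  by rewrite ltnS expn_gt0.
by rewrite leq_mul2r leq_add2r Sr orbT.
Qed.

End Regimes.

(** * Numerical estimates *)

(** With [2^k = N k] this says [k <= 2 sqrt N], so the term [k] in [live_bound] is of no larger
    order than a square root. Equality holds at [k = 4], where the induction starts. *)
Lemma expn3_le (k : nat) : (k ^ 3 <= 4 * 2 ^ k)%N.
Proof.
case: k => [|[|[|[|k]]]] //; elim: k => [//|k IH].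
rewrite [(2 ^ _)%N]expnS; move: IH; set P := (2 ^ k.+4)%N; rewrite !expnS expn0; nia.
Qed.

Section Estimates.
Variables (R : realType) (k : nat).
Hypothesis k0 : (0 < k)%N.
Local Notation M := ((2 ^ k)%:R : R).
Local Notation n := ((2 * 2 ^ k)%:R : R).
Local Notation l := (ln n).

Lemma ln2_ge : 1 / 2 <= ln 2 :> R.
Proof.
rewrite -ler_expR lnK ?posrE //.
have := expR_ge1Dx (- (1 / 2) : R); rewrite expRN.
have := expR_gt0 (1 / 2 : R); set x := expR _ => x0 le.
have : x * (1 + - (1 / 2)) <= x * x^-1 by rewrite ler_pM2l.
rewrite divff ?gt_eqF //; lra.
Qed.

Lemma ln_lower : k.+1%:R / 2 <= l.
Proof.
rewrite -expnS natrX lnXn // -mulr_natr.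
by have := ln2_ge; have : 0 <= k.+1%:R :> R by []; nra.
Qed.

Lemma ln_ge1 : 1 <= l.
Proof.
apply: le_trans ln_lower; have : 1 <= k%:R :> R by rewrite ler1n.
by rewrite [k.+1%:R]mulrSr; lra.
Qed.

Lemma k_le_ln : k%:R <= 2 * l.
Proof. by have := ln_lower; rewrite [k.+1%:R]mulrSr; lra. Qed.

(** As [2^k + 1 <= n], the count is at most the exponential of [(s + 2) (r + 1) l]. The tail
    exponent [eps^2 n / 16] is split in half: one half cancels the count, the other leaves
    [1 / n < eps / 4]. *)
Lemma small_countP (eps : R) (s r : nat) :
  (s + 2)%:R * r.+1%:R * l <= eps ^+ 2 * n / 32 -> l <= eps ^+ 2 * n / 32 ->
  4 / n < eps -> small_count k eps s r.
Proof.
move=> small l_le n_lt; rewrite /small_count.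
have n0 : 0 < n by rewrite ltr0n muln_gt0 expn_gt0.
apply: (@le_lt_trans _ _ n^-1); last by lra.
have le1 : ((2 ^ k).+1 ^ ((s + 2) * r.+1))%:R <= expR ((s + 2)%:R * r.+1%:R * l).
  rewrite -natrM expRM_natl lnK ?posrE // -natrX ler_nat leq_exp2r ?muln_gt0 ?addn_gt0 ?orbT //.
  by rewrite mul2n -addnn -addn1 leq_add2l expn_gt0.
apply: (@le_trans _ _ (expR ((s + 2)%:R * r.+1%:R * l - eps ^+ 2 * M / 8))).
  by rewrite expRD ler_wpM2r ?expR_ge0.
rewrite -[X in _ <= X^-1](@lnK _ n) ?posrE // -expRN ler_expR.
by move: small l_le; rewrite natrM; lra.
Qed.

Lemma block_size_mul : (k %| 2 ^ k)%N -> (2 ^ k %/ k)%:R * k%:R = M.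
Proof. by move=> dv; rewrite -natrM divnK. Qed.

Hypothesis dvk : (k %| 2 ^ k)%N.
Local Notation N := ((2 ^ k %/ k)%:R : R).

Lemma block_size_gt0 : 0 < N.
Proof. by rewrite ltr0n divn_gt0 // ltnW // ltn_expl. Qed.

Lemma live_bound_ge0 w : 0 <= live_bound R k w.
Proof.
rewrite /live_bound mulr_ge0 ?addr_ge0 ?mulr_ge0 ?sqrtr_ge0 ?invr_ge0 //.
by rewrite le_min ler01 divr_ge0.
Qed.

(** Taking 1 in the minimum gives [4 sqrt M / N = 4 k / sqrt M]; then [k <= 2 l] and
    [sqrt n <= 3/2 sqrt M] give [12 = 4 * 2 * 3/2]. *)
Lemma live_bound_gates w : (w <= 2 ^ k)%N -> live_bound R k w <= 12 * l / Num.sqrt n.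
Proof.
move=> wM; have M0 : 0 < M by rewrite ltr0n expn_gt0.
have N0 := block_size_gt0; have NkM := block_size_mul dvk.
have k0' : 1 <= k%:R :> R by rewrite ler1n.
set mu := Num.sqrt M; have mu0 : 0 < mu by rewrite sqrtr_gt0.
have mumu : mu * mu = M by rewrite -expr2 sqr_sqrtr ?ltW.
set q := Num.sqrt n; have q0 : 0 < q by rewrite sqrtr_gt0 ltr0n muln_gt0 expn_gt0.
have qq : q * q = 2 * M by rewrite -expr2 sqr_sqrtr // natrM.
have qmu : q <= 3 / 2 * mu by rewrite leNgt; apply/negP => lt; nra.
have kmu : k%:R <= 2 * mu.
  have k3 : k%:R ^+ 3 <= 4 * M by rewrite -natrX -natrM ler_nat expn3_le.
  rewrite leNgt; apply/negP => lt.
  have : 4 * M < k%:R ^+ 2 by rewrite -mumu; nra.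
  by move: k3; rewrite exprS; nra.
have wmu : Num.sqrt w%:R <= mu by rewrite ler_wsqrtr // ler_nat.
apply: (@le_trans _ _ (N^-1 * (4 * mu))).
  rewrite /live_bound ler_pM ?addr_ge0 ?mulr_ge0 ?sqrtr_ge0 ?invr_ge0 //.
  - by rewrite le_min ler01 divr_ge0.
  - by apply: ler_piMl; rewrite ?invr_ge0 ?ler0n // ge_min lexx.
  - lra.
rewrite [leLHS]mulrC ler_pdivrMr // mulrAC ler_pdivlMr //.
have := k_le_ln; set L := ln _ => kL.
have : k%:R * N <= 2 * L * N by rewrite ler_pM2r.
by rewrite mulrC NkM -mumu; nra.
Qed.

(** Linear in [w], so that it sums to the number of wires. For [w <= N] the minimum is bounded by
    [w / N], otherwise by 1, and both cases give [4 w / (N sqrt N)]; then [n <= 4 l N] gives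
    [32 = 4 * 8]. *)
Lemma live_bound_wires w :
  live_bound R k w <= 32 * w%:R * (l * Num.sqrt l) / (n * Num.sqrt n).
Proof.
have M0 : 0 < M by rewrite ltr0n expn_gt0.
have N0 := block_size_gt0; have NkM := block_size_mul dvk.
have k0' : 1 <= k%:R :> R by rewrite ler1n.
have kl := k_le_ln.
have l1 := ln_ge1.
have nM : n = 2 * M by rewrite natrM.
set nu := Num.sqrt N; have nu0 : 0 < nu by rewrite sqrtr_gt0.
have nunu : nu * nu = N by rewrite -expr2 sqr_sqrtr ?ltW.
set q := Num.sqrt n; have q0 : 0 < q by rewrite sqrtr_gt0 ltr0n muln_gt0 expn_gt0.
have qq : q * q = n by rewrite -expr2 sqr_sqrtr.
set L := ln n in kl l1 *; set sl := Num.sqrt L.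
have sl0 : 0 < sl by rewrite sqrtr_gt0; lra.
have slsl : sl * sl = L by rewrite -expr2 sqr_sqrtr //; lra.
have qnu : q <= 2 * sl * nu.
  rewrite leNgt; apply/negP => lt.
  have : 4 * L * N < n.
    rewrite -qq -slsl -nunu.
    have : (2 * sl * nu) * (2 * sl * nu) < q * q.
      by apply: ltr_pM => //; rewrite !mulr_ge0 ?ltW.
    by nra.
  by rewrite nM -NkM; nra.
have knu : k%:R <= 2 * nu.
  have k3 : k%:R ^+ 3 <= 4 * M by rewrite -natrX -natrM ler_nat expn3_le.
  rewrite leNgt; apply/negP => lt.
  have : 4 * N < k%:R ^+ 2 by rewrite -nunu; nra.
  by move: k3; rewrite -NkM exprS; nra.
pose x : R := Num.sqrt w%:R; have x0 : 0 <= x by rewrite sqrtr_ge0.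
have xx : x * x = w%:R by rewrite -expr2 sqr_sqrtr.
apply: (@le_trans _ _ (4 * w%:R / (N * nu))).
  rewrite ler_pdivlMr ?mulr_gt0 // /live_bound -/x.
  have -> (a b : R) : a / N * b * (N * nu) = a * (b * nu).
    by field; rewrite gt_eqF.
  have [wN|wN] := leP w%:R N.
    apply: (@le_trans _ _ (w%:R / N * (4 * N))).
      apply: ler_pM; rewrite ?ge_min ?lexx ?orbT //.
      - by rewrite le_min ler01 divr_ge0.
      - by rewrite !mulr_ge0 ?addr_ge0 ?mulr_ge0 // ltW.
      have : x <= nu by rewrite ler_wsqrtr.
      by rewrite -nunu; nra.
    by rewrite mulrCA divfK ?gt_eqF.
  apply: (@le_trans _ _ (1 * ((k%:R + 2 * x) * nu))).
    apply: ler_wpM2r; rewrite ?ge_min ?lexx //.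
    by rewrite !mulr_ge0 ?addr_ge0 ?mulr_ge0 // ltW.
  have : nu <= x by rewrite ler_wsqrtr // ltW.
  by rewrite -xx; nra.
have Nnu : n * q <= 8 * (L * sl) * (N * nu).
  have nN : n <= 4 * L * N by rewrite nM -NkM; nra.
  have -> : 8 * (L * sl) * (N * nu) = (4 * L * N) * (2 * sl * nu) by ring.
  by apply: ler_pM => //; apply: ltW.
rewrite ler_pdivrMr ?mulr_gt0 // mulrAC ler_pdivlMr ?mulr_gt0 //; last by rewrite -qq mulr_gt0.
have : w%:R * (n * q) <= w%:R * (8 * (L * sl) * (N * nu)) by rewrite ler_wpM2l.
nra.
Qed.

End Estimates.

Lemma powR_half (R : realType) (x : R) (a : nat) : 0 < x ->
  x `^ (a%:R + 1 / 2) = x ^+ a * Num.sqrt x.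
Proof.
move=> x0; rewrite powRD; last by rewrite (gt_eqF x0) implybT.
by rewrite powR_mulrn ?ltW // div1r powR12_sqrt ?ltW.
Qed.

(** * Lower bounds *)

Section LowerBounds.
Variables (R : realType) (k : nat).
Hypotheses (k0 : (0 < k)%N) (dvk : (k %| 2 ^ k)%N).
Local Notation V := (andreev_var k).
Local Notation n := ((2 * 2 ^ k)%:R : R).
Local Notation l := (ln n).
Local Notation q := (Num.sqrt n).
Variables (C : ltf_ltf R V) (f : bits V -> bool) (eps : R).
Hypotheses (Cf : computes C f) (eps01 : 0 < eps <= 1).
Hypothesis eps_large : 400 * l < eps ^+ 2 * n.
Hypothesis agree : 1 / 2 + eps <= agreement R f (@andreev k).

Let n0 : 0 < n. Proof. by rewrite ltr0n muln_gt0 expn_gt0. Qed.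
Let q0 : 0 < q. Proof. by rewrite sqrtr_gt0. Qed.
Let qq : q * q = n. Proof. by rewrite -expr2 sqr_sqrtr // ltW. Qed.
Let l1 : 1 <= l. Proof. exact: ln_ge1. Qed.
Let eps0 : 0 < eps. Proof. by case/andP: eps01. Qed.
Let N0 : (0 < 2 ^ k %/ k)%N. Proof. by have := block_size_gt0 R k0; rewrite ltr0n. Qed.

Let epsq2 : (eps * q) ^+ 2 = eps ^+ 2 * n. Proof. by rewrite exprMn [q ^+ 2]expr2 qq. Qed.

Let epsq3 : (eps * q) ^+ 3 = eps ^+ 3 * (n * q).
Proof. by rewrite exprMn [q ^+ 3]exprSr expr2 qq. Qed.

Lemma small_count_large (s r : nat) :
  (s + 2)%:R * r.+1%:R * l <= eps ^+ 2 * n / 32 -> small_count k eps s r.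
Proof.
move=> small; apply: small_countP => //; first by have := l1; have := eps_large; lra.
rewrite ltr_pdivrMr //; have := eps_large; have := l1; have := eps0.
case/andP: eps01 => _ e1; have := n0; set x := n; set L := ln _ => x0 e0 L1 eL.
have : eps ^+ 2 * x <= eps * x by rewrite ler_pM2r // expr2 ler_piMl // ltW.
lra.
Qed.

Lemma live_bound_sum_ge (B : R) : 16 * l <= eps * q ->
  \sum_(j < bottom_size C) live_bound R k
     #|ltf_inputs (bottom_gate (l := C) j) :&: block_vars| <= B ->
  eps ^+ 3 * n / (1024 * l ^+ 2) <= B.
Proof.
move=> large sumB; rewrite leNgt; apply/negP => lt.
have B0 : 0 <= B by apply: le_trans sumB; apply: sumr_ge0 => j _; apply: live_bound_ge0.
have e4 : 0 <= 4 * B / eps by rewrite divr_ge0 ?mulr_ge0 // ltW.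
(* The integer part of [4 B / eps] is the least [r] with [B < eps / 4 * (r + 1)]. *)
have /andP[rle ltr] := truncn_itv e4; set r := Num.trunc _ in rle ltr.
move: agree; rewrite leNgt => /negP[].
apply: (few_live_gates_agreement N0 Cf eps01 (r := r) sumB).
  by move: ltr; rewrite ltr_pdivrMr // => ltr; nra.
apply: small_count_large.
have kl := k_le_ln R k; have l1' := l1.
move: lt; rewrite ltr_pdivlMr ?mulr_gt0 ?exprn_gt0 //; try lra.
(* Half of the budget [eps^2 n / 32] pays for [4 B / eps]; the other half pays for the rounding term
   [4 l^2], by [16 l <= eps q]. *)
move=> lt; have lt' : 16 * l ^+ 2 * (B / eps) <= eps ^+ 2 * n / 64.
  rewrite mulrA ler_pdivrMr //; nra.
have le2 : 256 * l ^+ 2 <= eps ^+ 2 * n.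
  rewrite -epsq2 (_ : 256 * l ^+ 2 = (16 * l) ^+ 2); last by ring.
  by rewrite ler_pXn2r // nnegrE; [have := l1; lra|rewrite mulr_ge0 // ltW].
have r1 : r.+1%:R <= 4 * (B / eps) + 1 by move: rle; rewrite [r.+1%:R]mulrSr; lra.
have k1 : (k + 2)%:R <= 4 * l by rewrite natrD; lra.
apply: (@le_trans _ _ (4 * l * (4 * (B / eps) + 1) * l)); last by nra.
by rewrite ler_wpM2r ?ler_pM //; lra.
Qed.

Lemma gates_lower :
  1 / (1024 * 12) * (eps ^+ 3 * (n * q) / l ^+ 3) <= (gates C)%:R.
Proof.
have l0 : 0 < l by have := l1; lra.
have [large|small] := leP (16 * l) (eps * q).
  apply: (@le_trans _ _ (bottom_size C)%:R); last by rewrite ler_nat /gates.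
  have := @live_bound_sum_ge ((bottom_size C)%:R * (12 * l / q)) large.
  have sumB : \sum_(j < bottom_size C) live_bound R k
      #|ltf_inputs (bottom_gate (l := C) j) :&: block_vars|
      <= (bottom_size C)%:R * (12 * l / q).
    rewrite -[X in X%:R * _]card_ord mulr_natl -sumr_const; apply: ler_sum => j _.
    apply: live_bound_gates => //.
    apply: leq_trans (subset_leq_card (subsetIr _ _)) _.
    rewrite (_ : block_vars = [set (inr p : V) | p : 'I_k * 'I_(2 ^ k %/ k)]); last first.
      apply/setP => v; rewrite inE; case: v => [x|p]; apply/esym/imsetP.
        by case.
      by exists p.
    by rewrite (leq_trans (leq_imset_card _ _)) // card_prod !card_ord mulnC divnK.
  move=> /(_ sumB).
  move=> le; have c0 : 0 <= q / (12 * l) by rewrite divr_ge0 ?mulr_ge0 // ltW.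
  have := ler_wpM2r c0 le; congr (_ <= _).
    by move: l0; move: (l) => L L0; field; rewrite gt_eqF.
  by move: l0 q0; move: (l) (q) => L Q L0 Q0; field; rewrite !gt_eqF.
(* As [16^3 < 1024 * 12], the claimed bound is below 1 here, and the output gate alone suffices. *)
apply: (@le_trans _ _ 1); last by rewrite ler1n.
rewrite -epsq3 [leLHS]mulrA ler_pdivrMr ?exprn_gt0 // mul1r.
have : (eps * q) ^+ 3 <= (16 * l) ^+ 3.
  by rewrite ler_pXn2r // ?nnegrE ?mulr_ge0 // ltW.
by rewrite exprMn; have := exprn_gt0 3 l0; lra.
Qed.

Lemma wires_lower :
  1 / (1024 * 32) * (eps ^+ 3 * (n ^+ 2 * q) / (l ^+ 3 * Num.sqrt l)) <= (wires C)%:R.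
Proof.
have l0 : 0 < l by have := l1; lra.
set sl := Num.sqrt l; have sl0 : 0 < sl by rewrite sqrtr_gt0.
have slsl : sl * sl = l by rewrite -expr2 sqr_sqrtr // ltW.
have [large|small] := leP (16 * l) (eps * q).
  have := @live_bound_sum_ge ((wires C)%:R * (32 * (l * sl) / (n * q))) large.
  have sumB : \sum_(j < bottom_size C) live_bound R k
      #|ltf_inputs (bottom_gate (l := C) j) :&: block_vars|
      <= (wires C)%:R * (32 * (l * sl) / (n * q)).
    apply: (@le_trans _ _ ((\sum_(j < bottom_size C)
         #|ltf_inputs (bottom_gate (l := C) j) :&: block_vars|)%:R * (32 * (l * sl) / (n * q)))).
      rewrite natr_sum mulr_suml; apply: ler_sum => j _.
      apply: (le_trans (live_bound_wires _ k0 dvk _)).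
      by rewrite -/sl [32 * _%:R]mulrC -!mulrA.
    rewrite ler_wpM2r //.
      by rewrite divr_ge0 ?mulr_ge0 // ltW.
    rewrite ler_nat /wires (leq_trans _ (leq_addr _ _)) // leq_sum // => j _.
    by rewrite subset_leq_card // subsetIl.
  move=> /(_ sumB) le.
  have c0 : 0 <= n * q / (32 * (l * sl)) by rewrite divr_ge0 ?mulr_ge0 // ltW.
  have := ler_wpM2r c0 le; congr (_ <= _).
    by move: l0 sl0; move: (l) (sl) => L SL L0 SL0; field; rewrite !gt_eqF.
  move: l0 sl0 q0 n0; move: (l) (sl) (q) (n) => L SL Q X L0 SL0 Q0 X0.
  by field; rewrite !gt_eqF.
(* For [eps q < 16 l], too few wires would contradict the agreement through the deterministic choice
   of [J]. *)
rewrite leNgt; apply/negP => lt; move: agree; rewrite leNgt => /negP[].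
apply: (few_wires_agreement N0 Cf eps01).
apply: small_count_large; set r := (_ %/ _)%N.
have r_le : r%:R <= (wires C)%:R * (4 * l) / n.
  rewrite ler_pdivlMr //.
  have NkM := block_size_mul R dvk.
  have nN : n <= 4 * l * (2 ^ k %/ k)%:R.
    have := k_le_ln R k; have := block_size_gt0 R k0.
    by set L := ln _; rewrite natrM -NkM; nra.
  have rN : r%:R * (2 ^ k %/ k)%:R <= (wires C)%:R :> R by rewrite -natrM ler_nat leq_divM.
  have := ler_wpM2l (ler0n R r) nN; nra.
set y := _ / n in r_le.
have y0 : 0 <= y by rewrite divr_ge0 ?mulr_ge0 // ltW.
(* The assumed wire bound is cubic in [eps q]; two of the factors are at most [16 l], and
   [16^2 / (256 * 32) = 1 / 32]. *)
have ysl : y * sl <= eps * q / 32.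
  have : y * sl <= (eps * q) ^+ 3 / ((256 * 32) * l ^+ 2).
    have c0 : 0 <= 4 * (l * sl) / n by rewrite divr_ge0 ?mulr_ge0 // ltW.
    have := ler_wpM2r c0 (ltW lt); congr (_ <= _).
      by rewrite /y; move: n0; move: (l) (n) => L X X0; field; rewrite gt_eqF.
    rewrite epsq3; move: l0 sl0 q0 n0; move: (l) (sl) (q) (n) => L SL Q X L0 SL0 Q0 X0.
    by field; rewrite !gt_eqF.
  move/le_trans; apply; rewrite ler_pdivrMr ?mulr_gt0 ?exprn_gt0 //.
  have := mulr_ge0 (ltW eps0) (ltW q0); move: small; set E := eps * q => small E0.
  have : E ^+ 2 <= (16 * l) ^+ 2 by rewrite ler_pXn2r // ?nnegrE ?mulr_ge0 // ltW.
  have -> : E / 32 * ((256 * 32) * l ^+ 2) = E * (16 * l) ^+ 2 by field.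
  by rewrite [E ^+ 3]exprS => ?; rewrite ler_wpM2l.
have y2 : y ^+ 2 * l <= eps ^+ 2 * n / 1024.
  rewrite -epsq2 -slsl (_ : y ^+ 2 * _ = (y * sl) ^+ 2); last by ring.
  have := mulr_ge0 y0 (ltW sl0); move: ysl; set a := y * sl; set E := eps * q; nra.
have r0 : 0 <= r%:R :> R by [].
(* Crudely [(r + 2) (r + 1) <= 6 + 6 r^2]; then [eps_large] and [y2] apply, as
   [6/400 + 6/1024 < 1/32]. *)
apply: (@le_trans _ _ ((6 + 6 * y ^+ 2) * l)); last by have := eps_large; nra.
have r2 : r%:R ^+ 2 <= y ^+ 2 by rewrite ler_pXn2r // nnegrE.
rewrite ler_wpM2r ?ltW // natrD [r.+1%:R]mulrSr.
by move: r2; set x : R := r%:R; have := sqr_ge0 (x - 1); have := sqr_ge0 x; lra.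
Qed.

End LowerBounds.

Theorem theorem1p1 (R : realType) :
  exists (K c1 c2 : R) (n0 : nat),
    [/\ 0 < K, 0 < c1, 0 < c2 &
    forall (m k n : nat) (eps : R) (f : bits (andreev_var k) -> bool),
      k = (2 ^ m)%N -> n = (2 * 2 ^ k)%N -> (n0 <= n)%N ->
      K * Num.sqrt (ln n%:R / n%:R) < eps ->
      1 / 2 + eps <= agreement R f (@andreev k) ->
      forall C : ltf_ltf R (andreev_var k), computes C f ->
        c1 * (eps ^+ 3 * n%:R `^ (3 / 2) / ln n%:R ^+ 3) <= (gates C)%:R /\
        c2 * (eps ^+ 3 * n%:R `^ (5 / 2) / ln n%:R `^ (7 / 2)) <= (wires C)%:R].
Proof.
(* [20^2 = 400] is the constant in [eps_large]; the next two come from [gates_lower] and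
   [wires_lower]. *)
exists 20, (1 / (1024 * 12)), (1 / (1024 * 32)), 0%N.
split; [lra|lra|lra|move=> m k n eps f km nk _ Keps agree C Cf].
have k0 : (0 < k)%N by rewrite km expn_gt0.
have dvk : (k %| 2 ^ k)%N by rewrite {1}km dvdn_exp2l // km ltnW // ltn_expl.
rewrite {n}nk in Keps *.
have n0 : 0 < (2 * 2 ^ k)%:R :> R by rewrite ltr0n muln_gt0 expn_gt0.
have l1 := ln_ge1 R k0.
have l0 : 0 < ln (2 * 2 ^ k)%:R :> R by lra.
have eps0 : 0 < eps by apply: le_lt_trans Keps; rewrite mulr_ge0 ?sqrtr_ge0.
have e01 : 0 < eps <= 1.
  rewrite eps0 /=; have : agreement R f (@andreev k) <= 1; last by lra.
  rewrite /agreement ler_pdivrMr ?mul1r ?ler_nat ?max_card //.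
  by rewrite ltr0n card_ffun card_bool expn_gt0.
have el : 400 * ln (2 * 2 ^ k)%:R < eps ^+ 2 * (2 * 2 ^ k)%:R.
  rewrite -ltr_pdivrMr // -mulrA.
  have s0 : 0 <= ln (2 * 2 ^ k)%:R / (2 * 2 ^ k)%:R :> R by rewrite divr_ge0 // ltW.
  rewrite -[X in 400 * X](sqr_sqrtr s0).
  by have := sqrtr_ge0 (ln (2 * 2 ^ k)%:R / (2 * 2 ^ k)%:R : R); nra.
split.
  rewrite (_ : 3 / 2 = 1%:R + 1 / 2); last by field.
  rewrite powR_half // expr1.
  exact: (gates_lower k0 dvk Cf e01 el agree).
rewrite (_ : 5 / 2 = 2%:R + 1 / 2); last by field.
rewrite (_ : 7 / 2 = 3%:R + 1 / 2); last by field.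
rewrite !powR_half //.
exact: (wires_lower k0 dvk Cf e01 el agree).
Qed.
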